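(* Let $n\ge1$, $\delta>0$, $\beta<n+2$, and $\mu,\lambda^*\in\mathbb{R}$. For all $\nu\in\mathbb{R}^n$, $$M_b(\nu)=-\mu\|\nu\|^2\;{}_2F_3\left(1,\tfrac{n+2-\beta}{2};2,\tfrac{n+4}{2},\tfrac{n+4-\beta}{2};-\tfrac14\|\nu\|^2\delta^2\right)I-2\mu\;{}_1F_2\left(\tfrac{n+2-\beta}{2};\tfrac{n+4}{2},\tfrac{n+4-\beta}{2};-\tfrac14\|\nu\|^2\delta^2\right)\nu\otimes\nu,$$ and $$M_s(\nu)=-(\lambda^*-\mu)\;{}_1F_2\left(\tfrac{n+2-\beta}{2};\tfrac{n+2}{2},\tfrac{n+4-\beta}{2};-\tfrac14\|\nu\|^2\delta^2\right)^2\,\nu\otimes\nu.$$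
   Context: $B_\delta(0)$ is the ball of radius $\delta$ centered at $0$ in $\mathbb{R}^n$; $v\otimes w$ is the matrix with entries $v_iw_j$; $I$ is the $n\times n$ identity matrix. With $$c^{\delta,\beta}=\left(\frac{1}{2n}\int_{B_\delta(0)}\frac{\|w\|^2}{\|w\|^\beta}\,dw\right)^{-1}=\frac{2(n+2-\beta)\Gamma\left(\frac n2+1\right)}{\pi^{n/2}\delta^{n+2-\beta}},$$ the tensor multipliers (Fourier multipliers of the two parts of the linear peridynamic operator) are $$M_b(\nu)=(n+2)\,\mu\,c^{\delta,\beta}\int_{B_\delta(0)}\frac{w\otimes w}{\|w\|^{\beta+2}}\big(\cos(\nu\cdot w)-1\big)\,dw,$$ $$M_s(\nu)=-(\lambda^*-\mu)\frac{(c^{\delta,\beta})^2}{4}\left(\int_{B_\delta(0)}\frac{w}{\|w\|^\beta}\sin(\nu\cdot w)\,dw\right)\otimes\left(\int_{B_\delta(0)}\frac{w}{\|w\|^\beta}\sin(\nu\cdot w)\,dw\right).$$ Generalized hypergeometric function: ${}_pF_q(a_1,\dots,a_p;b_1,\dots,b_q;z)=\sum_{k\ge0}\frac{(a_1)_k\cdots(a_p)_k}{(b_1)_k\cdots(b_q)_k}\frac{z^k}{k!}$ with $(a)_k=a(a+1)\cdots(a+k-1)$. *)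

(* Defs.v *)
From HB Require Import structures.
From mathcomp Require Import all_boot all_order all_algebra.
From mathcomp Require Import all_classical all_reals all_analysis.

Set Implicit Arguments.
Unset Strict Implicit.
Unset Printing Implicit Defensive.

Import Order.TTheory GRing.Theory Num.Theory.
Import numFieldNormedType.Exports.

Local Open Scope classical_set_scope.
Local Open Scope ring_scope.

(* The library has no Lebesgue measure on R^n.  It is built here on n-tuples,
   whose library sigma-algebra is the one generated by the coordinates, as the
   n-fold product of the one-dimensional Lebesgue measure. *)

Section cons_measure.
Context (R : realType) (n : nat).
Local Notation T := (measurableTypeR R).

Definition cons_pair (p : T * n.-tuple T) : n.+1.-tuple T :=
  [the n.+1.-tuple T of p.1 :: p.2].

Definition uncons (t : n.+1.-tuple T) : T * n.-tuple T :=
  (thead t, [tuple of behead t]).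

Lemma cons_pairK : cancel cons_pair uncons.
Proof. by case=> x t; congr (_, _); apply: val_inj. Qed.

Lemma unconsK : cancel uncons cons_pair.
Proof. by move=> t; rewrite [RHS]tuple_eta; apply: val_inj. Qed.

Lemma measurable_cons_pair : measurable_fun [set: T * n.-tuple T] cons_pair.
Proof. exact: (measurable_cons measurable_fst measurable_snd). Qed.

Lemma measurable_uncons : measurable_fun [set: n.+1.-tuple T] uncons.
Proof.
apply: measurable_fun_pair; first exact: (@measurable_tnth _ T n.+1 ord0).
exact: measurable_behead.
Qed.

Variable m : {sigma_finite_measure set (n.-tuple T) -> \bar R}.

Definition cons_measure : set (n.+1.-tuple T) -> \bar R :=
  pushforward (@lebesgue_measure R \x m)%E cons_pair.

Let cons_measure0 : cons_measure set0 = 0%E.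
Proof. by rewrite /cons_measure /pushforward preimage_set0 measure0. Qed.

Let cons_measure_ge0 A : (0 <= cons_measure A)%E.
Proof. by rewrite /cons_measure /pushforward; exact: measure_ge0. Qed.

Let cons_measure_sigma_additive : semi_sigma_additive cons_measure.
Proof.
pose p := measure_function_pushforward__canonical__measure_function_Measure
  (@lebesgue_measure R \x m)%E measurable_cons_pair.
exact: (@measure_semi_sigma_additive _ _ _ p).
Qed.

HB.instance Definition _ := isMeasure.Build _ _ _ cons_measure
  cons_measure0 cons_measure_ge0 cons_measure_sigma_additive.

Let cons_measure_sigma_finite : sigma_finite setT cons_measure.
Proof.
have /sigma_finiteP[F [FT ndF Foo]] := sigma_finiteT (@lebesgue_measure R).
have /sigma_finiteP[G [GT ndG Goo]] := sigma_finiteT m.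
exists (fun i => uncons @^-1` (F i `*` G i)).
  rewrite -preimage_bigcup (_ : \bigcup_i _ = setT) ?preimage_setT//.
  apply/seteqP; split=> // -[x t] _.
  have [a _ Fx] : (\bigcup_i F i) x by rewrite -FT.
  have [b _ Gt] : (\bigcup_i G i) t by rewrite -GT.
  exists (maxn a b) => //; split => /=.
  - by move: x Fx; exact/subsetPset/ndF/leq_maxl.
  - by move: t Gt; exact/subsetPset/ndG/leq_maxr.
move=> i; have [mF Fi] := Foo i; have [mG Gi] := Goo i; split.
  by rewrite -[X in measurable X]setTI; apply: measurable_uncons => //;
     exact: measurableX.
rewrite /cons_measure /pushforward -comp_preimage.
rewrite (_ : uncons \o cons_pair = id); last first.
  by apply/funext => p /=; rewrite cons_pairK.
by rewrite preimage_id product_measure1E// lte_mul_pinfty// ge0_fin_numE.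
Qed.

HB.instance Definition _ := Measure_isSigmaFinite.Build _ _ _ cons_measure
  cons_measure_sigma_finite.

End cons_measure.

Fixpoint lebesgue_tuple (R : realType) (n : nat) :
    {sigma_finite_measure set (n.-tuple (measurableTypeR R)) -> \bar R} :=
  match n with
  | 0 => \d_([tuple] : 0.-tuple (measurableTypeR R))
  | n'.+1 => cons_measure (lebesgue_tuple R n')
  end.

Lemma lebesgue_tuple_box (R : realType) (n : nat)
    (A : 'I_n -> set (measurableTypeR R)) :
  (forall i, measurable (A i)) ->
  lebesgue_tuple R n [set t | forall i, A i (tnth t i)] =
  (\prod_(i < n) (@lebesgue_measure R (A i)))%E.
Proof.
elim: n A => [|n IH] A mA /=.
  by rewrite big_ord0 diracE mem_set// => -[].
rewrite big_ord_recl -IH => [|i]; last exact: mA.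
rewrite /cons_measure /pushforward.
rewrite -product_measure1E//; last first.
  have -> : [set t : n.-tuple (measurableTypeR R) |
      forall i, A (lift ord0 i) (tnth t i)] =
      \bigcap_(i in [set: 'I_n]) (@tnth n _ ^~ i @^-1` A (lift ord0 i)).
    by apply/seteqP; split=> t /= h i; [move=> _; exact: h|exact: (h i)].
  apply: fin_bigcap_measurable => // i _.
  by rewrite -[X in measurable X]setTI; exact: measurable_tnth.
congr product_measure1; apply/seteqP; split=> -[x t] /=.
- move=> h; split; first exact: (h ord0).
  by move=> i; have := h (lift ord0 i); rewrite tnthS.
- by case=> Ax h i; case: (unliftP ord0 i) => [j|] ->//; rewrite tnthS.
Qed.

Section euclidean.
Context (R : realType) (n : nat).

Definition rV_of_tuple (t : n.-tuple (measurableTypeR R)) : 'rV[R]_n :=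
  \row_i tnth t i.

Definition dot (v w : 'rV[R]_n) : R := \sum_i v 0 i * w 0 i.

(* The library norm `|v| on row vectors is the max norm. *)
Definition enorm (v : 'rV[R]_n) : R := Num.sqrt (\sum_i v 0 i ^+ 2).

Definition tensor (v w : 'rV[R]_n) : 'M[R]_n := \matrix_(i, j) (v 0 i * w 0 j).

Definition eball (delta : R) : set 'rV[R]_n := [set w | enorm w < delta].

Definition Rn_integral (D : set 'rV[R]_n) (f : 'rV[R]_n -> R) : R :=
  \int[lebesgue_tuple R n]_(t in rV_of_tuple @^-1` D) f (rV_of_tuple t).

Definition Rn_mxintegral (p q : nat) (D : set 'rV[R]_n)
    (F : 'rV[R]_n -> 'M[R]_(p, q)) : 'M[R]_(p, q) :=
  \matrix_(i, j) Rn_integral D (fun w => F w i j).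

End euclidean.

Section hypergeometric.
Context (R : realType).

Definition pochhammer (a : R) (k : nat) : R := \prod_(i < k) (a + i%:R).

Definition hypergeometric (a b : seq R) (z : R) : R :=
  limn (series (fun k : nat =>
    (\prod_(x <- a) pochhammer x k) / (\prod_(y <- b) pochhammer y k)
    * (z ^+ k / k`!%:R))).

End hypergeometric.

(* In the integrands below the value at w = 0 is irrelevant when n >= 1, since
   {0} is then negligible. *)
Section multipliers.
Context (R : realType) (n : nat) (delta beta : R).

Definition c_scale : R :=
  ((2 * n%:R)^-1 *
   Rn_integral (@eball R n delta) (fun w => enorm w ^+ 2 / enorm w `^ beta))^-1.

Definition M_b (mu : R) (nu : 'rV[R]_n) : 'M[R]_n :=
  ((n%:R + 2) * mu * c_scale) *:
  Rn_mxintegral (eball delta) (fun w =>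
    (cos (dot nu w) - 1) *: ((enorm w `^ (beta + 2))^-1 *: tensor w w)).

Definition sine_moment (nu : 'rV[R]_n) : 'rV[R]_n :=
  Rn_mxintegral (eball delta) (fun w =>
    sin (dot nu w) *: ((enorm w `^ beta)^-1 *: w)).

Definition M_s (mu lambda : R) (nu : 'rV[R]_n) : 'M[R]_n :=
  (- (lambda - mu) * (c_scale ^+ 2 / 4)) *:
  tensor (sine_moment nu) (sine_moment nu).

End multipliers.

(* Main.v *)
Require Import Defs.
From mathcomp Require Import all_boot all_order all_algebra.
From mathcomp Require Import all_classical all_reals all_analysis.
From mathcomp Require Import measurable_realfun ring lra.
Import Order.TTheory GRing.Theory Num.Theory.
Import numFieldNormedType.Exports.
Local Open Scope ring_scope.
Local Open Scope classical_set_scope.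

(* Write [<P>] for the integral of [P] over the unit ball. Scaling the Lebesgue
   measure shows that, for [P] homogeneous of degree [d], the integral of
   [P / N ^ g] over the ball of radius [delta], with [N] the Euclidean norm, is
   [delta ^ (n + d - g) * (n + d) / (n + d - g) * <P>].
   Since [G * (1 - N ^ 2)] vanishes on the unit sphere, Tonelli and the
   one-dimensional fundamental theorem of calculus give
   [<(d_i G) (1 - N ^ 2)> = 2 <w_i G>], hence [(n + m + 2) <w_i G> = <d_i G>]
   when [d_i G] is homogeneous of degree [m]. Applied to [G = (a.w) (nu.w) ^ m],
   this determines all the moments [<(nu.w) ^ m>], [<w_i (nu.w) ^ m>] and
   [<w_i w_j (nu.w) ^ m>] without polar coordinates or rotation invariance.
   Expanding the sine and the cosine into power series, dominated convergence
   lets us integrate term by term, and the terms are those of the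
   hypergeometric series. *)

Set Implicit Arguments.
Unset Strict Implicit.
Unset Printing Implicit Defensive.

(** * Tonelli and scaling for the measure on tuples *)

Section tuple_measure.
Context {R : realType}.
Local Notation RT := (measurableTypeR R).
Local Notation leb := (@lebesgue_measure R).
Local Notation L := (@lebesgue_tuple R).
Local Open Scope ereal_scope.

(** The obstacle is the weight [N ^ -g], which may be singular at the origin and is awkward on
    coordinate lines. Two integrands, [P] and [P / N ^ g], are therefore compared on one thin
    annulus next to the unit sphere: there the weight is nearly 1, while scaling alone tells which
    share of each ball integral the annulus carries. The factor [1 - N ^ 2] is chosen because on a
    line parallel to an axis it is a polynomial vanishing at both ends of the chord, so that
    calculus of polynomials in one variable suffices and no surface term arises. Its cost is one
    integral against [N ^ 2], which is the radial formula again, with [g = -2]. *)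

Lemma integral_cons n (f : n.+1.-tuple RT -> \bar R) :
  measurable_fun setT f -> (forall t, 0 <= f t) ->
  \int[L n.+1]_t f t = \int[leb \x L n]_p f (cons_pair p).
Proof.
move=> mf f0.
pose p := measure_function_pushforward__canonical__measure_function_Measure
  (@lebesgue_measure R \x L n)%E (@measurable_cons_pair R n).
transitivity (\int[p]_t f t); first by [].
by rewrite (ge0_integral_pushforward (@measurable_cons_pair R n)).
Qed.

Lemma tonelli_cons n (f : n.+1.-tuple RT -> \bar R) :
  measurable_fun setT f -> (forall t, 0 <= f t) ->
  \int[L n.+1]_t f t = \int[leb]_x \int[L n]_t f (cons_pair (x, t)).
Proof.
move=> mf f0; rewrite integral_cons// fubini_tonelli1//.
by apply: measurableT_comp => //; exact: measurable_cons_pair.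
Qed.

Lemma tonelli_cons_swap n (f : n.+1.-tuple RT -> \bar R) :
  measurable_fun setT f -> (forall t, 0 <= f t) ->
  \int[L n.+1]_t f t = \int[L n]_t \int[leb]_x f (cons_pair (x, t)).
Proof.
move=> mf f0; rewrite integral_cons// fubini_tonelli2//.
by apply: measurableT_comp => //; exact: measurable_cons_pair.
Qed.

Lemma measurable_integral_cons n (f : n.+1.-tuple RT -> \bar R) :
  measurable_fun setT f -> (forall t, 0 <= f t) ->
  measurable_fun [set: RT] (fun x => \int[L n]_t f (cons_pair (x, t))).
Proof.
move=> mf f0; apply: (@measurable_fun_fubini_tonelli_F _ _ _ _ _ (L n)
  (f \o @cons_pair R n)) => [|x]; last exact: f0.
by apply: measurableT_comp => //; exact: measurable_cons_pair.
Qed.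

(** The image of Lebesgue measure under multiplication by [r], rescaled by [r], gives every interval
    []a, b]] its length, hence is Lebesgue measure by uniqueness. *)
Lemma ge0_integral_scale1 (r : R) (f : RT -> \bar R) : (0 < r)%R ->
  measurable_fun setT f -> (forall x, 0 <= f x) ->
  \int[leb]_x f (r * x)%R = (r^-1)%:E * \int[leb]_x f x.
Proof.
move=> r0 mf f0.
have mr : measurable_fun setT ( *%R r : RT -> RT) by exact: measurable_funM.
have r0' : (0 <= r)%R by exact: ltW.
pose p : {measure set RT -> \bar R} := 
  measure_function_pushforward__canonical__measure_function_Measure leb mr.
pose m : {measure set RT -> \bar R} := mscale (NngNum r0') p.
have -> : \int[leb]_x f x = \int[m]_x f x.
  apply: eq_measure_integral => A mA _.
  apply: lebesgue_measure_unique => // _ [[a b]] _ <-.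
  transitivity (r%:E * leb `](r^-1 * a)%R, (r^-1 * b)%R]%classic); last first.
    congr (_ * leb _); apply/seteqP; split => x /=; rewrite !in_itv/=
      ![(r^-1 * _)%R]mulrC ltr_pdivrMr// ler_pdivlMr// [(x * r)%R]mulrC//.
  rewrite !lebesgue_measure_itv/= !lte_fin ltr_pM2l ?invr_gt0//.
  case: ifPn => _; last by rewrite mule0.
  by rewrite -!EFinD -EFinM -mulrBr mulVKf// gt_eqF.
rewrite ge0_integral_mscale//= muleA -EFinM mulVf ?gt_eqF// mul1e.
by rewrite ge0_integral_pushforward.
Qed.

Definition tscale n (r : R) (t : n.-tuple RT) : n.-tuple RT :=
  [tuple of map ( *%R r) t].

Lemma measurable_tscale n (r : R) : measurable_fun setT (@tscale n r).
Proof.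
apply/measurable_fun_tnthP => i.
rewrite (_ : _ \o _ = (fun t => r * tnth t i)%R); last first.
  by apply/funext => t /=; rewrite tnth_map.
by apply: measurable_funM => //; exact: measurable_tnth.
Qed.

Lemma tscale_cons n (r : R) x (t : n.-tuple RT) :
  tscale r (cons_pair (x, t)) = cons_pair ((r * x)%R, tscale r t).
Proof. exact: val_inj. Qed.

Lemma ge0_integral_tscale n (r : R) (f : n.-tuple RT -> \bar R) : (0 < r)%R ->
  measurable_fun setT f -> (forall t, 0 <= f t) ->
  \int[L n]_t f (tscale r t) = (r ^- n)%:E * \int[L n]_t f t.
Proof.
move=> r0; elim: n f => [|n IH] f mf f0.
  rewrite expr0 invr1 mul1e; apply: eq_integral => t _; congr f.
  by apply: eq_from_tnth => -[].
have mc : measurable_fun setT (f \o @cons_pair R n).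
  by apply: measurableT_comp => //; exact: measurable_cons_pair.
rewrite tonelli_cons//; last first.
  by apply: measurableT_comp => //; exact: measurable_tscale.
under eq_integral => x _.
  under eq_integral do rewrite tscale_cons.
  rewrite (IH (fun t => f (cons_pair ((r * x)%R, t))))//; last first.
    by apply: (measurableT_comp mc); exact: measurable_pair1.
  over.
rewrite (@ge0_integral_scale1 _ (fun x => (r ^- n)%:E * \int[L n]_t f (cons_pair (x, t))))//.
- rewrite ge0_integralZl//=.
  + by rewrite muleA -EFinM exprS invfM tonelli_cons.
  + exact: measurable_integral_cons.
  + by move=> x _; exact: integral_ge0.
  + by rewrite lee_fin invr_ge0 exprn_ge0// ltW.
- apply: measurable_funeM.
  exact: measurable_integral_cons.
- move=> x; rewrite mule_ge0 ?integral_ge0//.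
  by rewrite lee_fin invr_ge0 exprn_ge0// ltW.
Qed.

Definition tset n (t : n.-tuple RT) (i : 'I_n) (x : R) : n.-tuple RT :=
  [tuple if j == i then x else tnth t j | j < n].

Lemma tset0_cons n (t : n.-tuple RT) x y :
  tset (cons_pair (x, t)) ord0 y = cons_pair (y, t).
Proof.
apply: eq_from_tnth => j; rewrite tnth_mktuple.
by case: (unliftP ord0 j) => [k|] ->//; rewrite eq_sym (negbTE (neq_lift _ _)) !tnthS.
Qed.

Lemma tset_lift_cons n (t : n.-tuple RT) x y i :
  tset (cons_pair (x, t)) (lift ord0 i) y = cons_pair (x, tset t i y).
Proof.
apply: eq_from_tnth => j; rewrite tnth_mktuple.
case: (unliftP ord0 j) => [k|] ->; last by rewrite (negbTE (neq_lift _ _)).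
by rewrite (inj_eq lift_inj) !tnthS tnth_mktuple.
Qed.

(** Tonelli allows coordinate [i] to be integrated innermost: earlier coordinates are frozen by the
    induction, and the swapped order serves once [i] comes first. Two nonnegative functions are
    compared because the use below is for the positive and negative parts of one function. *)
Lemma ge0_eq_integral_lines n (i : 'I_n) (f g : n.-tuple RT -> \bar R) :
  measurable_fun setT f -> (forall t, 0 <= f t) ->
  measurable_fun setT g -> (forall t, 0 <= g t) ->
  (forall t, \int[leb]_x f (tset t i x) = \int[leb]_x g (tset t i x)) ->
  \int[L n]_t f t = \int[L n]_t g t.
Proof.
elim: n i f g => [[]//|n IH] i f g mf f0 mg g0 fg.
case: (unliftP ord0 i) => [k|] ik; subst i.
- rewrite !tonelli_cons//; apply: eq_integral => x _.
  apply: (IH k) => //.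
  + apply: (measurableT_comp (f := f \o @cons_pair R n)); last exact: measurable_pair1.
    by apply: measurableT_comp => //; exact: measurable_cons_pair.
  + apply: (measurableT_comp (f := g \o @cons_pair R n)); last exact: measurable_pair1.
    by apply: measurableT_comp => //; exact: measurable_cons_pair.
  + move=> t; have := fg (cons_pair (x, t)).
    under eq_integral do rewrite tset_lift_cons.
    by under [in X in _ = X]eq_integral do rewrite tset_lift_cons.
- rewrite !tonelli_cons_swap//; apply: eq_integral => t _.
  have := fg (cons_pair (0%R, t)).
  under eq_integral do rewrite tset0_cons.
  by under [in X in _ = X]eq_integral do rewrite tset0_cons.
Qed.

End tuple_measure.

(** * Euclidean norm and balls *)

Section vectors.
Context {R : realType} {n : nat}.
Implicit Types (a v w : 'rV[R]_n).
Local Notation RT := (measurableTypeR R).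
Local Notation T := (n.-tuple RT).

Lemma enorm_ge0 w : 0 <= enorm w. Proof. exact: sqrtr_ge0. Qed.

Lemma sqr_enorm w : enorm w ^+ 2 = \sum_i w 0 i ^+ 2.
Proof. by rewrite sqr_sqrtr// sumr_ge0// => i _; exact: sqr_ge0. Qed.

Lemma enormZ (r : R) w : 0 <= r -> enorm (r *: w) = r * enorm w.
Proof.
move=> r0; rewrite /enorm.
under eq_bigr do rewrite mxE exprMn.
by rewrite -mulr_sumr sqrtrM ?sqr_ge0// sqrtr_sqr ger0_norm.
Qed.

Lemma ler_coord_enorm w i : `|w 0 i| <= enorm w.
Proof.
rewrite -(ler_pXn2r (n := 2)) ?nnegrE ?enorm_ge0// real_normK ?num_real//.
rewrite sqr_enorm (bigD1 i)//= lerDl sumr_ge0// => j _; exact: sqr_ge0.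
Qed.

Lemma enorm_eq0 w : enorm w = 0 -> w = 0.
Proof.
move=> w0; apply/rowP => i; rewrite mxE; apply/eqP; rewrite -normr_eq0.
by rewrite eq_le normr_ge0 -w0 ler_coord_enorm.
Qed.

Lemma dotZr a (r : R) w : dot a (r *: w) = r * dot a w.
Proof. by rewrite /dot mulr_sumr; apply: eq_bigr => i _; rewrite mxE mulrCA. Qed.

Lemma ler_dot a w : `|dot a w| <= (\sum_i `|a 0 i|) * enorm w.
Proof.
rewrite mulr_suml; apply: le_trans (ler_norm_sum _ _ _) _.
by apply: ler_sum => i _; rewrite normrM ler_wpM2l// ler_coord_enorm.
Qed.

Lemma dot_delta w i : dot (delta_mx 0 i) w = w 0 i.
Proof.
rewrite /dot (bigD1 i)//= mxE !eqxx mul1r big1 ?addr0// => j ji.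
by rewrite mxE (negbTE ji) andbF mul0r.
Qed.

Lemma rV_of_tscale (r : R) (t : T) :
  rV_of_tuple (tscale r t) = r *: rV_of_tuple t.
Proof. by apply/rowP => i; rewrite !mxE tnth_map. Qed.

Lemma measurable_dot a :
  measurable_fun [set: T] (fun t => dot a (rV_of_tuple t)).
Proof.
apply: measurable_sum => i; apply: measurable_funM => //.
rewrite (_ : (fun _ => _) = (fun t : T => tnth t i)); last first.
  by apply/funext => t; rewrite mxE.
exact: measurable_tnth.
Qed.

Lemma measurable_enorm : measurable_fun [set: T] (fun t => enorm (rV_of_tuple t)).
Proof.
apply: (measurableT_comp (f := @Num.sqrt R)).
  by apply: continuous_measurable_fun; exact: sqrt_continuous.
apply: measurable_sum => i; apply: measurable_funX.
rewrite (_ : (fun _ => _) = (fun t : T => tnth t i)); last first.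
  by apply/funext => t; rewrite mxE.
exact: measurable_tnth.
Qed.

Lemma measurable_eball (r : R) :
  measurable (@rV_of_tuple R n @^-1` eball r).
Proof.
rewrite (_ : _ @^-1` _ = (fun t => enorm (rV_of_tuple t)) @^-1` `]-oo, r[%classic).
  by rewrite -[X in measurable X]setTI; exact: measurable_enorm.
by apply/seteqP; split => t /=; rewrite /eball/= in_itv.
Qed.

Lemma measurable_box (A : set RT) : measurable A ->
  measurable [set t : T | forall i, A (tnth t i)].
Proof.
move=> mA; have -> : [set t : T | forall i, A (tnth t i)] =
  \bigcap_(i in [set: 'I_n]) (@tnth n _ ^~ i @^-1` A).
  by apply/seteqP; split=> t /= h i; [move=> _; exact: h|exact: (h i)].
apply: fin_bigcap_measurable => // i _.
by rewrite -[X in measurable X]setTI; exact: measurable_tnth.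
Qed.

Lemma lebesgue_eball_lty (r : R) :
  (lebesgue_tuple R n (@rV_of_tuple R n @^-1` eball r) < +oo)%E.
Proof.
apply: (@le_lt_trans _ _
    (lebesgue_tuple R n [set t | forall i, `[- r, r] (tnth t i)])).
  apply: le_measure; rewrite ?inE; first exact: measurable_eball.
    exact: (measurable_box (A := `[- r, r]%classic)).
  move=> t /= tr i; rewrite in_itv/= -ler_norml.
  have := ler_coord_enorm (rV_of_tuple t) i; rewrite mxE => /le_trans; apply.
  exact: ltW.
rewrite (lebesgue_tuple_box (A := fun=> `[- r, r]%classic))//.
have [c ->] : exists c, lebesgue_measure (`[- r, r]%classic : set RT) = c%:E.
  rewrite lebesgue_measure_itv/=; case: ifP => _; last by exists 0.
  by exists (r + r); rewrite -EFinD opprK.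
by rewrite prodEFin ltry.
Qed.

Lemma lebesgue_eball_gt0 (r : R) : 0 < r ->
  (0 < lebesgue_tuple R n (@rV_of_tuple R n @^-1` eball r))%E.
Proof.
(* The cube of side [s] lies in the ball since [n * s ^ 2 < r ^ 2]; dividing by [n + 1] also covers
   [n = 0]. *)
move=> r0; pose s := r / n.+1%:R.
have s0 : 0 < s by rewrite divr_gt0.
apply: (@lt_le_trans _ _
    (lebesgue_tuple R n [set t | forall i, `[0, s] (tnth t i)])).
  rewrite (lebesgue_tuple_box (A := fun=> `[0, s]%classic))//.
  rewrite lebesgue_measure_itv/= lte_fin s0 -EFinD subr0 prodEFin lte_fin.
  by rewrite prodr_gt0.
apply: le_measure; rewrite ?inE; first exact: (measurable_box (A := `[0, s]%classic)).
  exact: measurable_eball.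
move=> t /= ts; rewrite /eball/= -(ltr_pXn2r (n := 2)) ?nnegrE ?enorm_ge0 ?ltW// sqr_enorm.
apply: (@le_lt_trans _ _ (\sum_(i < n) s ^+ 2)).
  apply: ler_sum => i _; rewrite mxE; have /[!in_itv]/= /andP[t0 t1] := ts i.
  by rewrite ler_pXn2r// nnegrE ltW.
rewrite sumr_const card_ord -mulr_natl expr_div_n mulrCA gtr_pMr ?exprn_gt0//.
rewrite ltr_pdivrMr ?exprn_gt0// mul1r -natrX ltr_nat.
by rewrite -mulnn leq_pmull.
Qed.

(** Annuli of positive inner radius exhaust the ball only up to the origin, which is a box with a
    side of length 0. For [n = 0] it would be a point of mass 1. *)
Lemma lebesgue_tuple_origin : (0 < n)%N ->
  lebesgue_tuple R n [set t | enorm (rV_of_tuple t) = 0] = 0%E.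
Proof.
move=> n0; rewrite (_ : [set _ | _] = [set t | forall i, [set 0] (tnth t i)]).
  rewrite (lebesgue_tuple_box (A := fun=> [set 0]%classic))//.
  by rewrite lebesgue_measure_set1 (bigD1 (Ordinal n0))//= mul0e.
apply/seteqP; split => t /=.
  by move=> /enorm_eq0/rowP h i; have := h i; rewrite !mxE.
move=> h; rewrite /enorm big1 ?sqrtr0// => i _; rewrite mxE h expr0n//.
Qed.

End vectors.

(** * Radial weights *)

Section sandwich.
Context {R : realType}.

(** This is division by [h] followed by [h -> 0]. No limit is taken: [1 + x <= expR x] gives
    [a * e * (1 - (c + a) * h) <= b * f] for all [h > 0], and one good [h] refutes
    [b * f < a * e]. *)
Lemma expR_sandwich_le (a b c e f : R) : 0 < a -> 0 < b -> 0 <= c ->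
  0 <= e -> 0 <= f ->
  (forall h, 0 < h -> (1 - expR (- (a * h))) * e <=
                      expR (c * h) * ((1 - expR (- (b * h))) * f)) ->
  a * e <= b * f.
Proof.
move=> a0 b0 c0 e0 f0 H.
have H1 h : 0 < h -> a * e * (1 - (c + a) * h) <= b * f.
  move=> h0.
  have E1 : 1 - expR (- (b * h)) <= b * h.
    by have := expR_ge1Dx (- (b * h)); lra.
  have E2 : a * h * expR (- (a * h)) <= 1 - expR (- (a * h)).
    have := expR_ge1Dx (a * h); rewrite -(ler_pM2r (expR_gt0 (- (a * h)))).
    by rewrite expRxMexpNx_1; lra.
  have E3 : 1 - (c + a) * h <= expR (- ((c + a) * h)).
    by have := expR_ge1Dx (- ((c + a) * h)); lra.
  have E4 : a * h * expR (- (a * h)) * e <= expR (c * h) * (b * h * f).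
    apply: le_trans (ler_wpM2r e0 E2) _; apply: le_trans (H h h0) _.
    by rewrite ler_wpM2l ?expR_ge0// ler_wpM2r.
  have E5 : a * e * expR (- ((c + a) * h)) <= b * f.
    rewrite -(ler_pM2l h0) -(ler_pM2l (expR_gt0 (c * h))).
    rewrite (_ : - _ = - (c * h) + - (a * h)); last by ring.
    rewrite expRD.
    rewrite (_ : _ * (h * _) =
      (expR (c * h) * expR (- (c * h))) * (a * h * expR (- (a * h)) * e)); last by ring.
    by rewrite expRxMexpNx_1 mul1r (le_trans E4)// ler_wpM2l ?expR_ge0//; lra.
  by apply: le_trans E5; rewrite ler_wpM2l// mulr_ge0// ltW.
rewrite leNgt; apply/negP => lt.
have ae0 : 0 < a * e by apply: le_lt_trans lt; rewrite mulr_ge0// ltW.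
have ca0 : 0 < c + a by rewrite ltr_wpDl.
(* With this [h] the left side of [H1] is the midpoint of [a * e] and [b * f]. *)
have h0 : 0 < (a * e - b * f) / (2 * (a * e) * (c + a)).
  by rewrite divr_gt0 ?subr_gt0// (mulr_gt0 (mulr_gt0 _ ae0) ca0).
have := H1 _ h0.
rewrite (_ : _ * (1 - _) = a * e - (a * e - b * f) / 2); first lra.
field; rewrite !gt_eqF//; nra.
Qed.

Lemma expR_sandwich (a b c e f : R) : 0 < a -> 0 < b -> 0 <= c ->
  0 <= e -> 0 <= f ->
  (forall h, 0 < h ->
    expR (- (c * h)) * ((1 - expR (- (b * h))) * f) <=
      (1 - expR (- (a * h))) * e <=
    expR (c * h) * ((1 - expR (- (b * h))) * f)) ->
  a * e = b * f.
Proof.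
move=> a0 b0 c0 e0 f0 H; apply/eqP; rewrite eq_le; apply/andP; split.
  by apply: (expR_sandwich_le a0 b0 c0) => // h /H /andP[].
apply: (expR_sandwich_le b0 a0 c0) => // h /H /andP[+ _].
by rewrite -(ler_pM2l (expR_gt0 (c * h))) mulrA expRxMexpNx_1 mul1r.
Qed.

End sandwich.

(** * Integrals of homogeneous functions over annuli and balls *)

Section homogeneous.
Context {R : realType} {n : nat}.
Hypothesis n_gt0 : (0 < n)%N.
Local Notation RT := (measurableTypeR R).
Local Notation T := (n.-tuple RT).
Local Notation L := (lebesgue_tuple R n).
Local Notation N := (fun t : T => enorm (rV_of_tuple t)).
Local Notation B r := (@rV_of_tuple R n @^-1` eball r).

(** Half-open, so that adjacent annuli tile a larger one and inner radius 0 gives the open ball. *)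
Definition annulus (r s : R) : set T :=
  [set t | r <= enorm (rV_of_tuple t) < s].

Lemma measurable_annulus r s : measurable (annulus r s).
Proof.
rewrite (_ : annulus r s = N @^-1` `[r, s[%classic).
  by rewrite -[X in measurable X]setTI; exact: measurable_enorm.
by apply/seteqP; split => t /=; rewrite /annulus/= in_itv.
Qed.

Lemma annulus0 s : annulus 0 s = B s.
Proof. by apply/seteqP; split => t; rewrite /annulus/= enorm_ge0. Qed.

Section powers.
Variables (e : R) (G : T -> R).
Hypothesis mG : measurable_fun setT G.
Hypothesis G0 : forall t, 0 <= G t.
Hypothesis homG : forall r t, 0 < r -> G (tscale r t) = r `^ e * G t.

Let mGE D : measurable_fun D (EFin \o G).
Proof. by apply: measurable_funTS; apply/measurable_EFinP. Qed.

Let GE0 t : (0 <= (EFin \o G) t)%E.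
Proof. by rewrite lee_fin. Qed.

Lemma integral_annulus_scale r rho sigma : 0 < r ->
  (\int[L]_(t in annulus (r * rho) (r * sigma)) (G t)%:E =
  (r `^ (n%:R + e))%:E * \int[L]_(t in annulus rho sigma) (G t)%:E)%E.
Proof.
move=> r0; rewrite integral_mkcond [in RHS]integral_mkcond.
set f := (_ \_ _).
have mf : measurable_fun setT f.
  by apply/(measurable_restrictT (EFin \o G)); [exact: measurable_annulus|exact: mGE].
have f0 t : (0 <= f t)%E by apply: erestrict_ge0 => u _; rewrite lee_fin.
have := ge0_integral_tscale r0 mf f0.
have -> : (\int[L]_t f (tscale r t) =
    (r `^ e)%:E * \int[L]_t ((fun t => (G t)%:E) \_ (annulus rho sigma)) t)%E.
  rewrite -ge0_integralZl//; last 3 first.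
    by apply/(measurable_restrictT (EFin \o G)); [exact: measurable_annulus|exact: mGE].
    by move=> t _; apply: erestrict_ge0 => u _; rewrite lee_fin.
    by rewrite lee_fin powR_ge0.
  apply: eq_integral => t _; rewrite /f !patchE.
  have -> : (tscale r t \in annulus (r * rho) (r * sigma)) = (t \in annulus rho sigma).
    apply/idP/idP; rewrite !inE.
      by rewrite /annulus/= rV_of_tscale enormZ ?(ltW r0)// ler_pM2l// ltr_pM2l.
    by rewrite /annulus/= rV_of_tscale enormZ ?(ltW r0)// ler_pM2l// ltr_pM2l.
  by case: ifP; rewrite ?mule0// homG// EFinM.
move=> H.
have -> : r `^ (n%:R + e) = r ^+ n * r `^ e.
  rewrite powRD; last by rewrite (gt_eqF r0) implybT.
  by rewrite powR_mulrn// ltW.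
rewrite EFinM -muleA H muleA -EFinM.
by rewrite divff ?mul1e// gt_eqF// exprn_gt0.
Qed.

Lemma integral_annulus_split r s u : r <= s -> s <= u ->
  (\int[L]_(t in annulus r u) (G t)%:E =
   \int[L]_(t in annulus r s) (G t)%:E + \int[L]_(t in annulus s u) (G t)%:E)%E.
Proof.
move=> rs su; rewrite -(ge0_integral_setU L (measurable_annulus r s)
  (measurable_annulus s u) (mGE (D := _)) (fun t _ => GE0 t)); last first.
- rewrite disj_set2E; apply/eqP/seteqP; split => // t [] /=.
  by rewrite /annulus/= => /andP[_ /lt_geF ->].
- congr integral; apply/seteqP; split => t; rewrite /annulus/=.
    by case: (ltP (N t) s) => ts /andP[rt tu]; [left; apply/andP|right; apply/andP].
  case=> /andP[a b]; apply/andP; split => //.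
    exact: lt_le_trans su.
  exact: le_trans a.
Qed.

Hypothesis a_gt0 : 0 < n%:R + e.

(** The radii [expR (- k)] cut the punctured ball into shells whose integrals form a geometric
    series of ratio [q = expR (- (n + e))], and [n + e > 0] makes [q < 1]. One finite shell thus
    bounds the integral up to the singularity. *)
Lemma integral_ball_lty :
  (\int[L]_(t in annulus (expR (- 1)) 1) (G t)%:E < +oo)%E ->
  (\int[L]_(t in B 1) (G t)%:E < +oo)%E.
Proof.
set A := integral _ _ _ => Aoo.
have A0 : (0 <= A)%E by apply: integral_ge0 => t _; exact: GE0.
have AE : A = (fine A)%:E by rewrite fineK// ge0_fin_numE.
pose q := expR (- 1) `^ (n%:R + e).
have q1 : 0 < 1 - q.
  by rewrite /q -expRM mulN1r subr_gt0 expR_lt1 oppr_lt0.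
(* The sum of the geometric series, and the fixed point of [K = q * K + A], which closes the
   induction. *)
pose K := fine A / (1 - q).
have EK k : (\int[L]_(t in annulus (expR (- k%:R)) 1) (G t)%:E <= K%:E)%E.
  elim: k => [|k IH].
    rewrite (_ : annulus _ _ = set0) ?integral_set0.
      by rewrite lee_fin (divr_ge0 (fine_ge0 A0) (ltW q1)).
    apply/seteqP; split => // t; rewrite /annulus/= oppr0 expR0.
    by case/andP => /le_lt_trans/[apply]; rewrite ltxx.
  have h1 : expR (- k.+1%:R) <= expR (- 1) :> R by rewrite ler_expR lerN2 ler1n.
  have h2 : expR (- 1) <= 1 :> R by rewrite expR_le1 oppr_le0.
  rewrite (integral_annulus_split h1 h2).
  rewrite -/A.
  (* The inner annulus is the dilate by [expR (- 1)] of the one in the induction hypothesis. *)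
  rewrite (_ : expR (- k.+1%:R) = expR (- 1) * expR (- k%:R)); last first.
    by rewrite -expRD -opprD -natr1 addrC.
  rewrite -[X in annulus _ X](mulr1 (expR (- 1))) integral_annulus_scale ?expR_gt0//.
  rewrite AE.
  have -> : K = q * K + fine A.
    by rewrite /K; field; exact: lt0r_neq0.
  rewrite EFinD leeD2r// EFinM.
  by apply: lee_wpmul2l => //; rewrite lee_fin powR_ge0.
have mN0 : measurable [set t | N t = 0].
  rewrite (_ : [set _ | _] = N @^-1` [set 0])//.
  by rewrite -[X in measurable X]setTI; exact: measurable_enorm.
rewrite (ge0_negligible_integral mN0 (measurable_eball 1) (mGE (D := _))
  (fun t _ => GE0 t) (lebesgue_tuple_origin n_gt0)).
have -> : B 1 `\` [set t | N t = 0] = \bigcup_k annulus (expR (- k%:R)) 1.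
  apply/seteqP; split => t /=; rewrite /annulus/=.
    move=> [t1 /eqP t0].
    have {}t0 : 0 < N t by rewrite lt_def t0 enorm_ge0.
    exists (Num.truncn (- ln (N t))).+1 => //; apply/andP; split => //.
    by rewrite -[leRHS](lnK (x := N t))// ler_expR lerNl ltW// truncnS_gt.
  move=> [k _ /andP[kt t1]]; split => // t0.
  by move: kt; rewrite t0 leNgt expR_gt0.
apply: (@le_lt_trans _ _ K%:E); last exact: ltry.
set F := fun k : nat => annulus (expR (- k%:R)) 1.
have ndF : nondecreasing_seq F.
  move=> i j ij; apply/subsetPset => t; rewrite /F /annulus/= => /andP[it ->].
  by rewrite andbT (le_trans _ it)// ler_expR lerN2 ler_nat.
have cv := ge0_nondecreasing_set_cvg_integral (mu := L) ndF
  (fun i => measurable_annulus _ _) (fun i => mGE (D := F i)) (fun i t _ => GE0 t).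
rewrite -(cvg_lim _ cv)//; apply: lime_le; first by apply: cvgP cv.
by apply: nearW => k; exact: EK.
Qed.

End powers.

Lemma integral_ball_annulus (P : T -> R) r s : measurable_fun setT P ->
  (forall t, 0 <= P t) -> 0 <= r -> r <= s ->
  (\int[L]_(t in B s) (P t)%:E =
   \int[L]_(t in B r) (P t)%:E + \int[L]_(t in annulus r s) (P t)%:E)%E.
Proof. by move=> mP P0 r0 rs; rewrite -!annulus0 -integral_annulus_split. Qed.

Lemma integral_ball_scale (e : R) (G : T -> R) r : measurable_fun setT G ->
  (forall t, 0 <= G t) ->
  (forall r t, 0 < r -> G (tscale r t) = r `^ e * G t) -> 0 < r ->
  (\int[L]_(t in B r) (G t)%:E =
  (r `^ (n%:R + e))%:E * \int[L]_(t in B 1) (G t)%:E)%E.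
Proof.
move=> mG G0 homG r0.
by have := integral_annulus_scale mG G0 homG 0 1 r0; rewrite mulr0 mulr1 !annulus0.
Qed.

(** The annulus is the unit ball minus its dilate by [expR (- h)], whose integral scaling gives;
    finiteness permits the subtraction. *)
Lemma integral_annulus_hom (e : R) (G : T -> R) h : measurable_fun setT G ->
  (forall t, 0 <= G t) ->
  (forall r t, 0 < r -> G (tscale r t) = r `^ e * G t) ->
  (\int[L]_(t in B 1) (G t)%:E < +oo)%E -> 0 < h ->
  (\int[L]_(t in annulus (expR (- h)) 1) (G t)%:E =
   ((1 - expR (- ((n%:R + e) * h))) * fine (\int[L]_(t in B 1) (G t)%:E))%:E)%E.
Proof.
move=> mG G0 homG Goo h0.
have := integral_ball_annulus mG G0 (expR_ge0 (- h)) (s := 1).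
rewrite expR_le1 oppr_le0 (ltW h0) => /(_ isT).
rewrite (integral_ball_scale mG G0 homG (expR_gt0 (- h))).
have I0 : (0 <= \int[L]_(t in B 1) (G t)%:E)%E.
  by apply: integral_ge0 => t _; rewrite lee_fin.
have : (\int[L]_(t in B 1) (G t)%:E = (fine (\int[L]_(t in B 1) (G t)%:E))%:E)%E.
  by rewrite fineK// ge0_fin_numE.
set I := fine _ => ->.
have : (0 <= \int[L]_(t in annulus (expR (- h)) 1) (G t)%:E)%E.
  by apply: integral_ge0 => t _; rewrite lee_fin.
rewrite -expRM mulNr [h * _]mulrC.
case: integral => [x| |]//= _; rewrite -EFinM -?EFinD.
by case=> H; congr EFin; lra.
Qed.

(* The integrals of [P / N `^ g] and [P] over a thin annulus [expR (- h) <= N < 1]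
   are comparable up to factors [expR (+- |g| h)], and both are known multiples
   of the integrals over the unit ball by homogeneity; let [h] tend to 0. *)
Lemma ge0_radial_integral (d : nat) (g delta : R) (P : T -> R) :
  measurable_fun setT P -> (forall t, 0 <= P t) ->
  (forall r t, 0 < r -> P (tscale r t) = r ^+ d * P t) ->
  (\int[L]_(t in B 1) (P t)%:E < +oo)%E ->
  0 < n%:R + d%:R - g -> 0 < delta ->
  (\int[L]_(t in B delta) (P t / enorm (rV_of_tuple t) `^ g)%:E =
  (delta `^ (n%:R + d%:R - g) * ((n%:R + d%:R) / (n%:R + d%:R - g)))%:E *
  \int[L]_(t in B 1) (P t)%:E)%E.
Proof.
move=> mP P0 hP Poo a0 delta0.
pose G t := P t / N t `^ g.
have mG : measurable_fun setT G.
  rewrite (_ : G = fun t => P t * N t `^ (- g)); last first.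
    by apply/funext => t; rewrite powRN.
  apply: measurable_funM => //.
  apply: (measurableT_comp (f := fun x : R => x `^ (- g))) => //.
  exact: measurable_enorm.
have G0 t : 0 <= G t by rewrite divr_ge0// powR_ge0.
have hP' r t : 0 < r -> P (tscale r t) = r `^ d%:R * P t.
  by move=> r0; rewrite powR_mulrn ?ltW// hP.
have hG r t : 0 < r -> G (tscale r t) = r `^ (d%:R - g) * G t.
  move=> r0; rewrite /G hP'// rV_of_tscale enormZ ?(ltW r0)// powRM ?(ltW r0) ?enorm_ge0//.
  rewrite powRB; last by rewrite (gt_eqF r0) implybT.
  by rewrite invfM; ring.
rewrite -addrA in a0.
have b0 : 0 < n%:R + d%:R :> R by rewrite ltr_wpDr// ltr0n.
have rG (h : R) (s : T) : 0 < h -> annulus (expR (- h)) 1 s ->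
   expR (- (`|g| * h)) * P s <= G s <= expR (`|g| * h) * P s.
  move: s => t h0 /andP[t1 t2].
  have N0 : 0 < N t by apply: lt_le_trans t1; exact: expR_gt0.
  have lnN : N t = expR (ln (N t)) by rewrite lnK.
  have l1 : - h <= ln (N t) by rewrite -ler_expR -lnN.
  have l2 : ln (N t) <= 0 by rewrite -ler_expR -lnN expR0 ltW.
  have l3 : `|g * ln (N t)| <= `|g| * h.
    by rewrite normrM ler_wpM2l// ler_norml l1 (le_trans l2)// ltW.
  have /andP[l4 l5] : - (`|g| * h) <= - (g * ln (N t)) <= `|g| * h.
    by move: l3; rewrite ler_norml lerN2 lerNl andbC.
  have -> : G t = expR (- (g * ln (N t))) * P t.
    by rewrite /G mulrC {1}lnN mulrC [g * _]mulrC -expRM expRN mulrC.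
  by rewrite !ler_wpM2r ?ler_expR.
have mPE D : measurable_fun D (EFin \o P).
  by apply: measurable_funTS; apply/measurable_EFinP.
have mGE D : measurable_fun D (EFin \o G).
  by apply: measurable_funTS; apply/measurable_EFinP.
have ZP c h : 0 <= c -> (c%:E * \int[L]_(t in annulus (expR (- h)) 1) (P t)%:E =
    \int[L]_(t in annulus (expR (- h)) 1) (c * P t)%:E)%E.
  move=> c0; rewrite -(ge0_integralZl_EFin L (measurable_annulus _ _)
    (f1 := EFin \o P) _ (mPE _) c0)// => t _.
  by rewrite lee_fin.
have upper h : 0 < h ->
    (\int[L]_(t in annulus (expR (- h)) 1) (G t)%:E <=
     (expR (`|g| * h))%:E * \int[L]_(t in annulus (expR (- h)) 1) (P t)%:E)%E.
  move=> h0; rewrite ZP ?expR_ge0//.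
  apply: ge0_le_integral.
  - exact: measurable_annulus.
  - by move=> t _; rewrite lee_fin.
  - exact: mGE.
  - by apply: measurable_funTS; apply/measurable_EFinP; exact: measurable_funM.
  - by move=> t /(rG _ _ h0)/andP[_]; rewrite lee_fin.
have lower h : 0 < h ->
    ((expR (- (`|g| * h)))%:E * \int[L]_(t in annulus (expR (- h)) 1) (P t)%:E <=
     \int[L]_(t in annulus (expR (- h)) 1) (G t)%:E)%E.
  move=> h0; rewrite ZP ?expR_ge0//.
  apply: ge0_le_integral.
  - exact: measurable_annulus.
  - by move=> t _; rewrite lee_fin mulr_ge0 ?expR_ge0.
  - by apply: measurable_funTS; apply/measurable_EFinP; exact: measurable_funM.
  - exact: mGE.
  - by move=> t /(rG _ _ h0)/andP[+ _]; rewrite lee_fin.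
(* Before [integral_annulus_hom] applies to [G], its integral must be known finite. The bound by [P]
   on the annulus with [h = 1] starts the geometric series. *)
have Goo : (\int[L]_(t in B 1) (G t)%:E < +oo)%E.
  apply: (integral_ball_lty mG G0 hG a0).
  apply: le_lt_trans (upper 1 ltr01) _.
  by rewrite (integral_annulus_hom mP P0 hP' Poo ltr01) -EFinM ltry.
rewrite (integral_ball_scale mG G0 hG delta0) -addrA EFinM -muleA; congr (_ * _)%E.
have PE : (\int[L]_(t in B 1) (P t)%:E = (fine (\int[L]_(t in B 1) (P t)%:E))%:E)%E.
  by rewrite fineK// ge0_fin_numE// integral_ge0// => t _; rewrite lee_fin.
have GE : (\int[L]_(t in B 1) (G t)%:E = (fine (\int[L]_(t in B 1) (G t)%:E))%:E)%E.
  by rewrite fineK// ge0_fin_numE// integral_ge0// => t _; rewrite lee_fin.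
rewrite PE GE -EFinM; congr EFin.
suff : (n%:R + (d%:R - g)) * fine (\int[L]_(t in B 1) (G t)%:E) =
    (n%:R + d%:R) * fine (\int[L]_(t in B 1) (P t)%:E).
  by move=> H; rewrite mulrAC -H mulrAC mulfV ?mul1r// gt_eqF.
apply: (expR_sandwich a0 b0 (normr_ge0 g)).
- by rewrite fine_ge0// integral_ge0// => t _; rewrite lee_fin.
- by rewrite fine_ge0// integral_ge0// => t _; rewrite lee_fin.
move=> h h0; have := lower h h0; have := upper h h0.
rewrite (integral_annulus_hom mG G0 hG Goo h0).
rewrite (integral_annulus_hom mP P0 hP' Poo h0).
by rewrite -!EFinM !lee_fin => -> ->.
Qed.

End homogeneous.

(** * Radial weights with signed integrands *)

Section radial.
Context {R : realType} {n : nat}.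
Hypothesis n_gt0 : (0 < n)%N.
Local Notation RT := (measurableTypeR R).
Local Notation T := (n.-tuple RT).
Local Notation L := (lebesgue_tuple R n).
Local Notation B r := (@rV_of_tuple R n @^-1` eball r).

Lemma bounded_integrable_ball (P : T -> R) C r : measurable_fun setT P ->
  (forall t, B r t -> `|P t| <= C) -> L.-integrable (B r) (EFin \o P).
Proof.
move=> mP PC; apply: measurable_bounded_integrable.
- exact: measurable_eball.
- exact: lebesgue_eball_lty.
- exact: measurable_funTS.
- exists C; split; first exact: num_real.
  by move=> M CM t /PC /le_trans; apply; exact: ltW.
Qed.

Lemma measurable_radial (P : T -> R) (g : R) : measurable_fun setT P ->
  measurable_fun setT (fun t => P t / enorm (rV_of_tuple t) `^ g).
Proof.
move=> mP; rewrite (_ : (fun _ => _) =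
    fun t => P t * enorm (rV_of_tuple t) `^ (- g)); last first.
  by apply/funext => t; rewrite powRN.
apply: measurable_funM => //.
apply: (measurableT_comp (f := fun x : R => x `^ (- g))) => //.
exact: measurable_enorm.
Qed.

(** Subtract the nonnegative case for [|P|] from that for [|P| + P]: both are homogeneous of degree
    [d], whatever the sign of [P]. *)
Lemma radial_integral (d : nat) (g delta C : R) (P : T -> R) :
  measurable_fun setT P ->
  (forall r t, 0 < r -> P (tscale r t) = r ^+ d * P t) ->
  (forall t, B 1 t -> `|P t| <= C) ->
  0 < n%:R + d%:R - g -> 0 < delta ->
  L.-integrable (B delta)
    (EFin \o (fun t => P t / enorm (rV_of_tuple t) `^ g)) /\
  \int[L]_(t in B delta) (P t / enorm (rV_of_tuple t) `^ g) =
  delta `^ (n%:R + d%:R - g) * ((n%:R + d%:R) / (n%:R + d%:R - g)) *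
  \int[L]_(t in B 1) P t.
Proof.
move=> mP hP PC a0 delta0.
have pos (Q : T -> R) : measurable_fun setT Q -> (forall t, 0 <= Q t) ->
    (forall r t, 0 < r -> Q (tscale r t) = r ^+ d * Q t) ->
    L.-integrable (B 1) (EFin \o Q) ->
    L.-integrable (B delta)
      (EFin \o (fun t => Q t / enorm (rV_of_tuple t) `^ g)) /\
    \int[L]_(t in B delta) (Q t / enorm (rV_of_tuple t) `^ g) =
    delta `^ (n%:R + d%:R - g) * ((n%:R + d%:R) / (n%:R + d%:R - g)) *
    \int[L]_(t in B 1) Q t.
  move=> mQ Q0 hQ iQ.
  have Qoo : (\int[L]_(t in B 1) (Q t)%:E < +oo)%E.
    by apply: integrable_lty => //; exact: measurable_eball.
  have I := ge0_radial_integral n_gt0 mQ Q0 hQ Qoo a0 delta0.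
  have QE : (\int[L]_(t in B 1) (Q t)%:E = (\int[L]_(t in B 1) Q t)%:E)%E.
    by rewrite fineK// ge0_fin_numE// integral_ge0// => t _; rewrite lee_fin.
  split; last by rewrite /Rintegral I QE.
  apply/integrableP; split.
    by apply: measurable_funTS; apply/measurable_EFinP; exact: measurable_radial.
  under eq_integral => t _.
    rewrite /= ger0_norm; last by rewrite divr_ge0// powR_ge0.
    over.
  by rewrite I QE -EFinM ltry.
have iP := bounded_integrable_ball mP PC.
have iA : L.-integrable (B 1) (EFin \o (fun t => `|P t|)).
  exact: integrable_norm iP.
have mA : measurable_fun setT (fun t => `|P t|).
  by apply: measurableT_comp.
have hA r t : 0 < r -> `|P (tscale r t)| = r ^+ d * `|P t|.
  by move=> r0; rewrite hP// normrM ger0_norm// exprn_ge0// ltW.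
have mS : measurable_fun setT (fun t => `|P t| + P t) by exact: measurable_funD.
have S0 t : 0 <= `|P t| + P t by have := ler_norm (- P t); rewrite normrN; lra.
have hS r t : 0 < r ->
    `|P (tscale r t)| + P (tscale r t) = r ^+ d * (`|P t| + P t).
  by move=> r0; rewrite hA// hP// mulrDr.
have iS : L.-integrable (B 1) (EFin \o (fun t => `|P t| + P t)).
  exact: (integrableD (measurable_eball 1) iA iP).
have [i1 e1] := pos _ mA (fun t => normr_ge0 _) hA iA.
have [i2 e2] := pos _ mS S0 hS iS.
have E : (fun t => P t / enorm (rV_of_tuple t) `^ g) =
    (fun t => (`|P t| + P t) / enorm (rV_of_tuple t) `^ g -
              `|P t| / enorm (rV_of_tuple t) `^ g).
  by apply/funext => t; rewrite -mulrBl addrAC subrr add0r.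
split.
  by rewrite E; exact: (integrableB (measurable_eball delta) i2 i1).
rewrite E (RintegralB (measurable_eball _) i2 i1) e1 e2 -mulrBr; congr (_ * _).
rewrite -(RintegralB (measurable_eball _) iS iA); apply: eq_Rintegral => t _.
by rewrite addrAC subrr add0r.
Qed.

End radial.

(** * Integration by parts on the unit ball *)

Section integration_by_parts.
Context {R : realType}.
Local Notation leb := (@lebesgue_measure R).

Lemma integrable_horner (p : {poly R}) (a b : R) :
  leb.-integrable `[a, b] (EFin \o horner p).
Proof.
apply: continuous_compact_integrable; first exact: segment_compact.
by apply: continuous_subspaceT; exact: continuous_horner.
Qed.

Lemma integral_deriv_horner (p : {poly R}) (a b : R) : a < b ->
  (\int[leb]_(x in `]a, b[) (p^`().[x])%:E = (p.[b] - p.[a])%:E)%E.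
Proof.
move=> ab.
rewrite -(@integral_itv_bndoo R a b _ true false); last first.
  apply: measurable_funTS; apply/measurable_EFinP.
  by apply: continuous_measurable_fun; exact: continuous_horner.
rewrite (continuous_FTC2 (F := horner p))//.
- by apply: continuous_subspaceT; exact: continuous_horner.
- split => [x _||].
  + exact: derivable_horner.
  + by apply: cvg_at_right_filter; exact: continuous_horner.
  + by apply: cvg_at_left_filter; exact: continuous_horner.
- by move=> x _; rewrite derivE.
Qed.

(** The set [x ^ 2 < c] is empty or an interval at whose two ends [p] vanishes, so the derivative
    integrates to 0. The conclusion is put as equality of the two parts, the form that
    [ge0_eq_integral_lines] takes. *)
Lemma integral_interval_deriv_patch (p : {poly R}) (c : R) :
  (forall x, x ^+ 2 = c -> p.[x] = 0) ->
  let h := fun x : R => if x ^+ 2 < c then p^`().[x] else 0 in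
  (\int[leb]_x (EFin \o h)^\+ x = \int[leb]_x (EFin \o h)^\- x)%E.
Proof.
move=> pc h.
have [c0|c0] := leP c 0.
  have -> : h = cst 0.
    apply/funext => x; rewrite /h ifF//; apply/negbTE; rewrite -leNgt.
    by rewrite (le_trans c0)// sqr_ge0.
  by apply: eq_integral => x _; rewrite funeposE funenegE/= oppr0.
pose r := Num.sqrt c.
have r0 : 0 < r by rewrite sqrtr_gt0.
have rc : r ^+ 2 = c by rewrite sqr_sqrtr// ltW.
have hE : (EFin \o h) = (EFin \o horner p^`()) \_ `]- r, r[.
  apply/funext => x; rewrite patchE /h/=.
  have -> : (x \in `]- r, r[%classic) = (x ^+ 2 < c).
    apply/idP/idP; rewrite inE/= in_itv/= -ltr_norml -rc -[x ^+ 2]real_normK ?num_real//;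
      by rewrite ltr_pXn2r// nnegrE// ltW.
  by case: ifP.
have ih : leb.-integrable setT (EFin \o h).
  have io : leb.-integrable `]- r, r[ (EFin \o horner p^`()).
    apply: integrableS (integrable_horner p^`() (- r) r) => //.
    exact: subset_itv_oo_cc.
  have mI : measurable (`]- r, r[%classic : set (measurableTypeR R)) by [].
  rewrite hE; exact: ((integrable_mkcond _ mI).1 io).
have : (\int[leb]_x (EFin \o h) x = 0)%E.
  rewrite hE -integral_mkcond integral_deriv_horner ?gtrN//.
  by rewrite !pc ?subrr// sqrrN.
rewrite integralE.
have := integrable_pos_fin_num measurableT ih.
have := integrable_neg_fin_num measurableT ih.
case: integral => // x _; case: integral => // y _.
by move=> [/eqP]; rewrite subr_eq0 => /eqP ->.
Qed.

End integration_by_parts.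

Section ball_moments.
Context {R : realType} {n : nat}.
Hypothesis n_gt0 : (0 < n)%N.
Local Notation RT := (measurableTypeR R).
Local Notation T := (n.-tuple RT).
Local Notation L := (lebesgue_tuple R n).
Local Notation B r := (@rV_of_tuple R n @^-1` eball r).
Local Notation w := rV_of_tuple.
Implicit Types (a b nu : 'rV[R]_n) (i j : 'I_n).

(* [G * (1 - N ^ 2)] vanishes on the unit sphere, so its [i]-th derivative
   integrates to 0 along every line in direction [i]. *)
Lemma ball_by_parts i (G dG : T -> R) :
  measurable_fun setT G -> measurable_fun setT dG ->
  (forall t, exists p : {poly R}, forall x,
    G (tset t i x) = p.[x] /\ dG (tset t i x) = p^`().[x]) ->
  \int[L]_(t in B 1) (dG t * (1 - enorm (rV_of_tuple t) ^+ 2)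
                      - 2 * (rV_of_tuple t 0 i * G t)) = 0.
Proof.
move=> mG mdG line; rewrite Rintegral_mkcond; set h := (_ \_ _).
have mcoord : measurable_fun setT (fun t : T => rV_of_tuple t 0 i).
  by under eq_fun do rewrite -dot_delta; exact: measurable_dot.
have mh : measurable_fun setT (EFin \o h).
  apply/measurable_EFinP; apply/(measurable_restrictT _ (measurable_eball 1)).
  apply: measurable_funTS; apply: measurable_funB.
    apply: measurable_funM => //; apply: measurable_funB => //.
    by apply: measurable_funX; exact: measurable_enorm.
  by apply: measurable_funM => //; exact: measurable_funM.
rewrite /Rintegral integralE.
suff -> : (\int[L]_t (EFin \o h)^\+ t = \int[L]_t (EFin \o h)^\- t)%E.
  (* Were both parts infinite, their difference would be an infinity, which [fine] sends to 0. *)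
  by case: integral => //= x; rewrite subrr.
apply: (ge0_eq_integral_lines (i := i)).
- exact: measurable_funepos.
- by move=> t; rewrite funepos_ge0.
- exact: measurable_funeneg.
- by move=> t; rewrite funeneg_ge0.
move=> t; have [p Hp] := line t.
(* The line meets the unit ball exactly where [x ^ 2 < c], and [1 - N ^ 2] restricts to [c - x ^ 2]
   on it; [q] is thus the restriction of [G * (1 - N ^ 2)]. *)
pose c := 1 - \sum_(j < n | j != i) rV_of_tuple t 0 j ^+ 2.
pose q := p * (c%:P - 'X^2).
have enormE x : enorm (rV_of_tuple (tset t i x)) ^+ 2 = x ^+ 2 + (1 - c).
  rewrite sqr_enorm (bigD1 i)//= mxE tnth_mktuple eqxx; congr (_ + _).
  rewrite /c opprB addrC subrK; apply: eq_bigr => j ji.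
  by rewrite !mxE tnth_mktuple (negbTE ji).
have ballE x : (enorm (rV_of_tuple (tset t i x)) < 1) = (x ^+ 2 < c).
  rewrite -(ltr_pXn2r (n := 2)) ?nnegrE ?enorm_ge0// enormE expr1n.
  by apply/idP/idP; lra.
have hE x : h (tset t i x) = if x ^+ 2 < c then q^`().[x] else 0.
  rewrite /h patchE.
  have -> : (tset t i x \in B 1) = (x ^+ 2 < c).
    by rewrite -ballE; apply/idP/idP; rewrite inE.
  case: ifP => // _; have [-> ->] := Hp x.
  rewrite enormE mxE tnth_mktuple eqxx /q derivM derivB derivC derivXn.
  rewrite !hornerE /=; ring.
have := @integral_interval_deriv_patch R q c.
move=> /(_ _)/=.
have q0 x : x ^+ 2 = c -> q.[x] = 0.
  by move=> xc; rewrite /q !hornerE/= xc subrr mulr0.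
move=> /(_ q0) H; apply: etrans (etrans H _); apply: eq_integral => x _.
- by rewrite !funeposE/= hE.
- by rewrite !funenegE/= hE.
Qed.

(** A class closed under sums and products that contains the coordinates and the norm, so that
    integrability of every polynomial integrand is read off its shape. *)
Definition tame r (P : T -> R) :=
  measurable_fun setT P /\ exists C, forall t, B r t -> `|P t| <= C.

Lemma tame_integrable r P : tame r P -> L.-integrable (B r) (EFin \o P).
Proof. by case=> mP [C PC]; exact: bounded_integrable_ball PC. Qed.

Lemma tameD r P Q : tame r P -> tame r Q -> tame r (fun t => P t + Q t).
Proof.
move=> [mP [C PC]] [mQ [D QD]]; split; first exact: measurable_funD.
exists (C + D) => t Bt; rewrite (le_trans (ler_normD _ _))//.
by rewrite lerD ?PC ?QD.
Qed.

Lemma tameM r P Q : tame r P -> tame r Q -> tame r (fun t => P t * Q t).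
Proof.
move=> [mP [C PC]] [mQ [D QD]]; split; first exact: measurable_funM.
by exists (C * D) => t Bt; rewrite normrM ler_pM ?PC ?QD.
Qed.

Lemma tame_cst r (c : R) : tame r (fun=> c).
Proof. by split; [exact: measurable_cst|exists `|c|]. Qed.

Lemma tame_dot r a : tame r (fun t => dot a (w t)).
Proof.
split; first exact: measurable_dot.
exists ((\sum_i `|a 0 i|) * r) => t Bt; apply: le_trans (ler_dot _ _) _.
by rewrite ler_wpM2l ?sumr_ge0// ltW.
Qed.

Lemma tame_coord r i : tame r (fun t => w t 0 i).
Proof.
rewrite (_ : (fun _ => _) = fun t => dot (delta_mx 0 i) (w t)).
  exact: tame_dot.
by apply/funext => t; rewrite dot_delta.
Qed.

Lemma tameX r P m : tame r P -> tame r (fun t => P t ^+ m).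
Proof.
move=> tP; elim: m => [|m IH].
  by under eq_fun do rewrite expr0; exact: tame_cst.
by under eq_fun do rewrite exprS; exact: tameM.
Qed.

Lemma tame_enorm r : tame r (fun t => enorm (w t)).
Proof.
split; first exact: measurable_enorm.
by exists r => t Bt; rewrite ger0_norm ?enorm_ge0// ltW.
Qed.

Lemma dot_tset a t i x : dot a (w (tset t i x)) =
  \sum_(j < n | j != i) a 0 j * w t 0 j + a 0 i * x.
Proof.
rewrite /dot (bigD1 i)//= mxE tnth_mktuple eqxx addrC; congr (_ + _).
by apply: eq_bigr => j ji; rewrite !mxE tnth_mktuple (negbTE ji).
Qed.

(** Here [D] is the [i]-th derivative of [G], homogeneous of degree [m]. The radial formula gives
    [<D N ^ 2> = (n + m) / (n + m + 2) * <D>], hence [<D (1 - N ^ 2)> = 2 / (n + m + 2) * <D>], to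
    be compared with [2 <w_i G>]. *)
Lemma moment_by_parts a nu m i :
  (n%:R + m%:R + 2) * \int[L]_(t in B 1) (w t 0 i * (dot a (w t) * dot nu (w t) ^+ m)) =
  a 0 i * \int[L]_(t in B 1) (dot nu (w t) ^+ m) +
  m%:R * nu 0 i * \int[L]_(t in B 1) (dot a (w t) * dot nu (w t) ^+ m.-1).
Proof.
pose G t := dot a (w t) * dot nu (w t) ^+ m.
pose D t := a 0 i * dot nu (w t) ^+ m +
  m%:R * nu 0 i * (dot a (w t) * dot nu (w t) ^+ m.-1).
have tnu k : tame 1 (fun t => dot nu (w t) ^+ k) by exact/tameX/tame_dot.
have ta k : tame 1 (fun t => dot a (w t) * dot nu (w t) ^+ k).
  by apply: tameM => //; exact: tame_dot.
have tD : tame 1 D.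
  by apply: tameD; apply: tameM => //; exact: tame_cst.
have tG : tame 1 (fun t => w t 0 i * G t).
  by apply: tameM; [exact: tame_coord|exact: ta].
have tDN : tame 1 (fun t => D t * enorm (w t) ^+ 2).
  by apply: tameM => //; apply: tameX; exact: tame_enorm.
have mB := measurable_eball (n := n) (1 : R).
have ID : \int[L]_(t in B 1) D t = a 0 i * \int[L]_(t in B 1) (dot nu (w t) ^+ m) +
    m%:R * nu 0 i * \int[L]_(t in B 1) (dot a (w t) * dot nu (w t) ^+ m.-1).
  rewrite RintegralD//; last 2 first.
  - by apply: tame_integrable; apply: tameM => //; exact: tame_cst.
  - by apply: tame_integrable; apply: tameM => //; exact: tame_cst.
  by rewrite !RintegralZl//; apply: tame_integrable.
have hD r t : 0 < r -> D (tscale r t) = r ^+ m * D t.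
  move=> r0; rewrite /D rV_of_tscale !dotZr.
  (* For [m = 0] the truncated exponent [m.-1] spoils the degree of the second term, but its
     coefficient [m] is 0. *)
  case: m {G D tD tG tDN ID} => [|m]; first by rewrite !expr0; ring.
  by rewrite !exprMn exprS/=; ring.
have IDN : \int[L]_(t in B 1) (D t * enorm (w t) ^+ 2) =
    (n%:R + m%:R) / (n%:R + m%:R + 2) * \int[L]_(t in B 1) D t.
  have [mD [C DC]] := tD.
  have a0 : 0 < n%:R + m%:R - (- 2) :> R by rewrite opprK -!natrD ltr0n addn2.
  have [_] := radial_integral n_gt0 mD hD DC a0 ltr01.
  rewrite powR1 mul1r opprK => <-; apply: eq_Rintegral => t _.
  by rewrite powRN invrK powR_mulrn// enorm_ge0.
have line t : exists p : {poly R}, forall x,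
    G (tset t i x) = p.[x] /\ D (tset t i x) = p^`().[x].
  pose l b : {poly R} := (\sum_(j < n | j != i) b 0 j * w t 0 j)%:P + (b 0 i)%:P * 'X.
  have lE b x : dot b (w (tset t i x)) = (l b).[x].
    by rewrite dot_tset /l !hornerE.
  exists (l a * l nu ^+ m) => x; split; first by rewrite /G !lE !hornerE.
  have dl b : deriv (l b) = (b 0 i)%:P.
    by rewrite /l derivD derivC derivM derivC derivX mul0r mulr1 !add0r.
  rewrite /D !lE derivM deriv_exp !dl !(hornerE, hornerMn) /=. ring.
have [mG _] : tame 1 G by exact: ta.
have [mD _] := tD.
have := ball_by_parts mG mD line.
under eq_Rintegral do rewrite mulrBr mulr1.
rewrite RintegralB//; last 2 first.
- exact: (integrableB mB (tame_integrable tD) (tame_integrable tDN)).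
- by apply: tame_integrable; apply: tameM => //; exact: tame_cst.
rewrite RintegralB ?tame_integrable// RintegralZl ?tame_integrable// IDN -ID.
rewrite /G => H.
have a0 : n%:R + m%:R + 2 != 0 :> R by rewrite -!natrD pnatr_eq0 addn2.
set I := \int[L]_(t in B 1) (_ * (_ * _)) in H *.
set J := \int[L]_(t in B 1) D t in H *.
have -> : I = J / (n%:R + m%:R + 2).
  apply: (mulfI (x := 2)); first by rewrite pnatr_eq0.
  move/eqP: H; rewrite subr_eq0 => /eqP <-; field; exact: a0.
by rewrite mulrC mulfVK.
Qed.

End ball_moments.

(** * Moments of the ball *)

Lemma integrable_sum_Rintegral d (T : measurableType d) (R : realType)
    (mu : {measure set T -> \bar R}) (D : set T) (I : Type) (s : seq I)
    (f : I -> T -> R) :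
  measurable D -> (forall x, mu.-integrable D (EFin \o f x)) ->
  mu.-integrable D (EFin \o (fun t => \sum_(x <- s) f x t)) /\
  \int[mu]_(t in D) (\sum_(x <- s) f x t) = \sum_(x <- s) \int[mu]_(t in D) f x t.
Proof.
move=> mD If; elim: s => [|x s [i1 IH]].
  rewrite big_nil; split.
    by under [fun _ => _]eq_fun do rewrite big_nil; exact: integrable0.
  by under eq_Rintegral do rewrite big_nil; rewrite Rintegral_cst ?mul0r.
split.
  under [fun _ => _]eq_fun do rewrite big_cons.
  exact: (integrableD mD (If x) i1).
under eq_Rintegral do rewrite big_cons.
by rewrite RintegralD// IH big_cons.
Qed.

Section moments.
Context {R : realType} {n : nat}.
Hypothesis n_gt0 : (0 < n)%N.
Local Notation RT := (measurableTypeR R).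
Local Notation T := (n.-tuple RT).
Local Notation L := (lebesgue_tuple R n).
Local Notation B r := (@rV_of_tuple R n @^-1` eball r).
Local Notation w := rV_of_tuple.
Implicit Types (nu : 'rV[R]_n) (i j : 'I_n).

Definition moment nu m : R := \int[L]_(t in B 1) (dot nu (w t) ^+ m).

Lemma tame_dotX r nu m : tame r (fun t : T => dot nu (w t) ^+ m).
Proof. exact/tameX/tame_dot. Qed.

Lemma moment_coord nu m i :
  (n%:R + m%:R + 2) * \int[L]_(t in B 1) (w t 0 i * dot nu (w t) ^+ m.+1) =
  m.+1%:R * nu 0 i * moment nu m.
Proof.
have := moment_by_parts n_gt0 nu nu m i.
under eq_Rintegral do rewrite -exprS.
move=> ->; rewrite -/(moment nu m); case: m => [|m]; first by ring.
under eq_Rintegral do rewrite -exprS.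
by rewrite -/(moment nu m.+1) -[m.+2%:R]natr1; ring.
Qed.

Lemma moment_coord2 nu m i j :
  (n%:R + m.+1%:R + 2) *
    \int[L]_(t in B 1) (w t 0 i * w t 0 j * dot nu (w t) ^+ m.+1) =
  (i == j)%:R * moment nu m.+1 +
  m.+1%:R * nu 0 i * \int[L]_(t in B 1) (w t 0 j * dot nu (w t) ^+ m).
Proof.
have := moment_by_parts n_gt0 (delta_mx 0 j) nu m.+1 i.
rewrite mxE eqxx /= -/(moment nu m.+1).
under eq_Rintegral do rewrite dot_delta mulrA.
move=> ->; congr (_ + _ * _).
by under eq_Rintegral do rewrite dot_delta.
Qed.

(** Expand one factor [nu.w] into coordinates and apply [moment_coord] to each: the squares of the
    coordinates of [nu] add up to [enorm nu ^ 2], so the moments depend on [nu] through its length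
    only. *)
Lemma momentSS nu m :
  (n%:R + m%:R + 2) * moment nu m.+2 =
  m.+1%:R * enorm nu ^+ 2 * moment nu m.
Proof.
have -> : moment nu m.+2 =
    \sum_i nu 0 i * \int[L]_(t in B 1) (w t 0 i * dot nu (w t) ^+ m.+1).
  transitivity (\int[L]_(t in B 1) (\sum_i nu 0 i * (w t 0 i * dot nu (w t) ^+ m.+1))).
    apply: eq_Rintegral => t _; rewrite exprS {1}/dot mulr_suml.
    by apply: eq_bigr => i _; rewrite mulrA.
  have mB := measurable_eball (n := n) (1 : R).
  have ti i : tame 1 (fun t => w t 0 i * dot nu (w t) ^+ m.+1).
    by apply: tameM; [exact: tame_coord|exact: tame_dotX].
  have Ii i : L.-integrable (B 1)
      (EFin \o (fun t => nu 0 i * (w t 0 i * dot nu (w t) ^+ m.+1))).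
    by apply: tame_integrable; apply: tameM; first exact: tame_cst.
  have [_ ->] := integrable_sum_Rintegral (index_enum 'I_n) mB Ii.
  by apply: eq_bigr => i _; rewrite RintegralZl//; exact: tame_integrable.
rewrite mulr_sumr sqr_enorm mulr_sumr mulr_suml; apply: eq_bigr => i _.
by rewrite mulrCA moment_coord; ring.
Qed.

(** Kept unevaluated: it is a factor of every even moment and of the inverse of [c_scale], and
    cancels between them. *)
Definition volume : R := \int[L]_(t in B 1) 1.

Lemma volume_gt0 : 0 < volume.
Proof.
rewrite /volume Rintegral_cst ?mul1r; last exact: measurable_eball.
by rewrite fine_gt0// lebesgue_eball_gt0//= lebesgue_eball_lty.
Qed.

Lemma moment_even nu k : moment nu k.*2 =
  volume * enorm nu ^+ k.*2 *
  \prod_(l < k) (l.*2.+1%:R / (n%:R + l.*2%:R + 2)).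
Proof.
elim: k => [|k IH].
  by rewrite big_ord0 /moment/=; under eq_Rintegral do rewrite expr0; rewrite mulr1 mulr1.
have a0 : n%:R + k.*2%:R + 2 != 0 :> R by rewrite -!natrD pnatr_eq0 addn2.
apply: (mulfI a0); rewrite doubleS momentSS IH big_ord_recr/= !exprS.
by field.
Qed.

Lemma moment_coord_odd nu k i :
  \int[L]_(t in B 1) (dot nu (w t) ^+ k.*2.+1 * w t 0 i) =
  k.*2.+1%:R / (n%:R + k.*2%:R + 2) * nu 0 i * moment nu k.*2.
Proof.
have a0 : n%:R + k.*2%:R + 2 != 0 :> R by rewrite -!natrD pnatr_eq0 addn2.
apply: (mulfI a0); under eq_Rintegral do rewrite mulrC.
by rewrite moment_coord; field.
Qed.

(** The two summands are the origin of the two tensors in [M_b]: the Kronecker symbol comes from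
    differentiating [w_j], the product [nu_i nu_j] from differentiating the power of [nu.w]. *)
Lemma moment_coord2_even nu k i j :
  (n%:R + k.*2%:R + 4) *
    \int[L]_(t in B 1) (dot nu (w t) ^+ k.*2.+2 * (w t 0 i * w t 0 j)) =
  k.*2.+1%:R / (n%:R + k.*2%:R + 2) * moment nu k.*2 *
  ((i == j)%:R * enorm nu ^+ 2 + k.*2.+2%:R * nu 0 i * nu 0 j).
Proof.
under eq_Rintegral do rewrite mulrC.
have := moment_coord2 nu k.*2.+1 i j.
have -> : n%:R + k.*2.+2%:R + 2 = n%:R + k.*2%:R + 4 :> R.
  by rewrite -[k.*2.+2%:R]natr1 -[k.*2.+1%:R]natr1; ring.
move=> ->; under eq_Rintegral do rewrite mulrC.
rewrite moment_coord_odd.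
have a0 : n%:R + k.*2%:R + 2 != 0 :> R by rewrite -!natrD pnatr_eq0 addn2.
have -> : moment nu k.*2.+2 = k.*2.+1%:R / (n%:R + k.*2%:R + 2) *
    enorm nu ^+ 2 * moment nu k.*2.
  by apply: (mulfI a0); rewrite momentSS; field.
by ring.
Qed.

(** * Moments against the singular weights *)

Section weighted.
Variables (delta beta : R).
Hypotheses (delta_gt0 : 0 < delta) (beta_lt : beta < n%:R + 2).

(** The polynomial has degree [2 k + 2], so the radial formula contributes [n + 2 k + 2] in the
    numerator, which cancels the denominator in [moment_coord_odd]. The bound on [beta] is
    integrability for [k = 0]. *)
Lemma weighted_moment1 nu k i :
  L.-integrable (B delta) (EFin \o (fun t =>
    dot nu (w t) ^+ k.*2.+1 * (w t 0 i / enorm (w t) `^ beta))) /\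
  \int[L]_(t in B delta)
    (dot nu (w t) ^+ k.*2.+1 * (w t 0 i / enorm (w t) `^ beta)) =
  delta `^ (n%:R + k.*2%:R + 2 - beta) / (n%:R + k.*2%:R + 2 - beta) *
  (k.*2.+1%:R * nu 0 i * moment nu k.*2).
Proof.
have [mP [C PC]] : tame 1 (fun t : T => dot nu (w t) ^+ k.*2.+1 * w t 0 i).
  by apply: tameM; [exact: tame_dotX|exact: tame_coord].
have a0 : n%:R + k.*2%:R + 2 != 0 :> R by rewrite -!natrD pnatr_eq0 addn2.
have kE : n%:R + k.*2.+2%:R = n%:R + k.*2%:R + 2 :> R.
  by rewrite -[k.*2.+2%:R]natr1 -[k.*2.+1%:R]natr1; ring.
have b0 : 0 < n%:R + k.*2.+2%:R - beta.
  by have := ler0n R k.*2; move: beta_lt; rewrite kE; lra.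
have hP (r : R) (t : T) : 0 < r ->
    dot nu (w (tscale r t)) ^+ k.*2.+1 * w (tscale r t) 0 i =
    r ^+ k.*2.+2 * (dot nu (w t) ^+ k.*2.+1 * w t 0 i).
  by move=> r0; rewrite rV_of_tscale dotZr mxE exprMn [r ^+ k.*2.+2]exprS; ring.
have [] := radial_integral n_gt0 mP hP PC b0 delta_gt0.
have E t : dot nu (w t) ^+ k.*2.+1 * w t 0 i / enorm (w t) `^ beta =
    dot nu (w t) ^+ k.*2.+1 * (w t 0 i / enorm (w t) `^ beta) by rewrite mulrA.
under eq_fun do rewrite E; move=> iP.
move=> ->; split => //; rewrite moment_coord_odd kE; field.
by rewrite a0 -kE gt_eqF.
Qed.

(** Degree [2 k + 4] against weight [beta + 2] leaves the same exponent as in [weighted_moment1];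
    the numerator [n + 2 k + 4] of the radial formula is the factor on the left of
    [moment_coord2_even]. *)
Lemma weighted_moment2 nu k i j :
  L.-integrable (B delta) (EFin \o (fun t => dot nu (w t) ^+ k.*2.+2 *
    (w t 0 i * w t 0 j / enorm (w t) `^ (beta + 2)))) /\
  \int[L]_(t in B delta) (dot nu (w t) ^+ k.*2.+2 *
    (w t 0 i * w t 0 j / enorm (w t) `^ (beta + 2))) =
  delta `^ (n%:R + k.*2%:R + 2 - beta) / (n%:R + k.*2%:R + 2 - beta) *
  (k.*2.+1%:R / (n%:R + k.*2%:R + 2) * moment nu k.*2 *
  ((i == j)%:R * enorm nu ^+ 2 + k.*2.+2%:R * nu 0 i * nu 0 j)).
Proof.
have [mP [C PC]] : tame 1
    (fun t : T => dot nu (w t) ^+ k.*2.+2 * (w t 0 i * w t 0 j)).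
  by apply: tameM; [exact: tame_dotX|apply: tameM; exact: tame_coord].
have kE : n%:R + k.*2.+4%:R = n%:R + k.*2%:R + 4 :> R.
  rewrite -[k.*2.+4%:R]natr1 -[k.*2.+3%:R]natr1.
  by rewrite -[k.*2.+2%:R]natr1 -[k.*2.+1%:R]natr1; ring.
have kE' : n%:R + k.*2.+4%:R - (beta + 2) = n%:R + k.*2%:R + 2 - beta.
  by rewrite kE; ring.
have b0 : 0 < n%:R + k.*2.+4%:R - (beta + 2).
  by have := ler0n R k.*2; move: beta_lt; rewrite kE; lra.
have hP (r : R) (t : T) : 0 < r ->
    dot nu (w (tscale r t)) ^+ k.*2.+2 * (w (tscale r t) 0 i * w (tscale r t) 0 j) =
    r ^+ k.*2.+4 * (dot nu (w t) ^+ k.*2.+2 * (w t 0 i * w t 0 j)).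
  move=> r0; rewrite rV_of_tscale dotZr !mxE exprMn.
  by rewrite [r ^+ k.*2.+4]exprS [r ^+ k.*2.+3]exprS; ring.
have [] := radial_integral n_gt0 mP hP PC b0 delta_gt0.
have E t : dot nu (w t) ^+ k.*2.+2 * (w t 0 i * w t 0 j) / enorm (w t) `^ (beta + 2) =
    dot nu (w t) ^+ k.*2.+2 * (w t 0 i * w t 0 j / enorm (w t) `^ (beta + 2)).
  by rewrite [RHS]mulrA.
under eq_fun do rewrite E; move=> iP.
move=> ->; split => //; rewrite kE' kE -moment_coord2_even; field.
by rewrite -kE' gt_eqF.
Qed.

(** The radial formula is used twice: on the constant 1 with [g = -2], which gives the integral of
    [N ^ 2], then on [N ^ 2] with [g = beta]. The factors [n] and [n + 2] drop out. *)
Lemma c_scaleE :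
  c_scale n delta beta =
  2 * (n%:R + 2 - beta) / (delta `^ (n%:R + 2 - beta) * volume).
Proof.
have n0 : 0 < n%:R :> R by rewrite ltr0n.
have sqr_integral : \int[L]_(t in B 1) (enorm (w t) ^+ 2) =
    n%:R / (n%:R + 2) * volume.
  have [mP [C PC]] : tame 1 (fun t : T => 1) by exact: tame_cst.
  have hP (r : R) (t : T) : 0 < r -> 1 = r ^+ 0 * 1 :> R.
    by move=> _; rewrite expr0 mulr1.
  have b0 : 0 < n%:R + 0%:R - (- 2) :> R by rewrite addr0; lra.
  have [_] := radial_integral n_gt0 mP hP PC b0 ltr01.
  rewrite powR1 mul1r addr0 opprK -/volume => <-; apply: eq_Rintegral => t _.
  by rewrite mul1r powRN invrK powR_mulrn// enorm_ge0.
have [mP [C PC]] : tame 1 (fun t : T => enorm (w t) ^+ 2).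
  by apply: tameX; exact: tame_enorm.
have hP (r : R) (t : T) : 0 < r ->
    enorm (w (tscale r t)) ^+ 2 = r ^+ 2 * enorm (w t) ^+ 2.
  by move=> r0; rewrite rV_of_tscale enormZ ?exprMn// ltW.
have b0 : 0 < n%:R + 2 - beta by move: beta_lt; lra.
have [_] := radial_integral n_gt0 mP hP PC b0 delta_gt0.
rewrite sqr_integral /c_scale /Rn_integral => ->.
have v0 := volume_gt0; have d0 := powR_gt0 (n%:R + 2 - beta) delta_gt0.
have n2 : 0 < n%:R + 2 :> R by lra.
by field; rewrite !gt_eqF.
Qed.

End weighted.

End moments.

(** * Term by term integration *)

Section series_integral.
Context {R : realType}.

Lemma series_exp_coeff_le (y : R) k : 0 <= y -> series (exp_coeff y) k <= expR y.
Proof.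
move=> y0; apply: (nondecreasing_cvgn_le (u_ := series (exp_coeff y))).
  apply: nondecreasing_series => i _ _.
  by rewrite /exp_coeff/= divr_ge0// exprn_ge0.
exact: is_cvg_series_exp_coeff.
Qed.

(** Since [x ^ (2 k + m) = (x ^ 2) ^ k * x ^ m], the exponential series dominates. The factor
    [|x| ^ m] is not bounded away: it tames the weight at the origin, which alone need not be
    integrable. *)
Lemma ler_norm_power_series (c : nat -> R) m x X K :
  (forall k, `|c k| <= k`!%:R^-1) -> `|x| <= X ->
  `|\sum_(0 <= k < K) c k * x ^+ (k.*2 + m)| <= expR (X ^+ 2) * `|x| ^+ m.
Proof.
move=> c1 xX; apply: le_trans (ler_norm_sum _ _ _) _.
apply: (@le_trans _ _ (series (exp_coeff (`|x| ^+ 2)) K * `|x| ^+ m)).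
  rewrite /series/= mulr_suml; apply: ler_sum => k _.
  rewrite normrM normrX exprD -mul2n exprM mulrA ler_wpM2r ?exprn_ge0//.
  by rewrite /exp_coeff/= mulrC ler_wpM2l ?exprn_ge0.
rewrite ler_wpM2r ?exprn_ge0//; apply: le_trans (series_exp_coeff_le _ _) _.
  exact: sqr_ge0.
rewrite ler_expR ler_pXn2r// nnegrE//; exact: le_trans xX.
Qed.

Context {n : nat}.
Local Notation RT := (measurableTypeR R).
Local Notation T := (n.-tuple RT).
Local Notation L := (lebesgue_tuple R n).
Local Notation B r := (@rV_of_tuple R n @^-1` eball r).
Local Notation w := rV_of_tuple.

Lemma cvg_series_integral (c : nat -> R) m (U : R -> R) (nu : 'rV[R]_n)
    (g : T -> R) (delta : R) :
  (forall k, `|c k| <= k`!%:R^-1) ->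
  (forall x, series (fun k => c k * x ^+ (k.*2 + m)) @ \oo --> U x) ->
  measurable_fun setT U -> measurable_fun setT g ->
  (forall k, L.-integrable (B delta)
     (EFin \o (fun t => dot nu (w t) ^+ (k.*2 + m) * g t))) ->
  series (fun k => c k *
    \int[L]_(t in B delta) (dot nu (w t) ^+ (k.*2 + m) * g t)) @ \oo -->
  \int[L]_(t in B delta) (U (dot nu (w t)) * g t).
Proof.
move=> c1 cU mU mg Ig.
have mB := measurable_eball (n := n) delta.
pose X := (\sum_i `|nu 0 i|) * delta.
pose u K t := \sum_(0 <= k < K) c k * (dot nu (w t) ^+ (k.*2 + m) * g t).
have Ic k : L.-integrable (B delta)
    (EFin \o (fun t => c k * (dot nu (w t) ^+ (k.*2 + m) * g t))).
  exact: (integrableZl mB (c k) (Ig k)).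
have Iu K := integrable_sum_Rintegral (index_iota 0 K) mB Ic.
have uE K t : u K t = (\sum_(0 <= k < K) c k * dot nu (w t) ^+ (k.*2 + m)) * g t.
  by rewrite /u mulr_suml; apply: eq_bigr => k _; rewrite mulrA.
(* The dominating function: up to a constant, the absolute value of the integrand for [k = 0]; [X]
   bounds [|nu.w|] on the ball. *)
pose G t := expR (X ^+ 2) * `|dot nu (w t) ^+ m * g t|.
have IG : L.-integrable (B delta) (EFin \o G).
  exact: (integrableZl mB (expR (X ^+ 2)) (integrable_norm (Ig 0%N))).
have uG K t : B delta t -> `|u K t| <= G t.
  move=> Bt; rewrite uE /G !normrM mulrA ler_wpM2r// normrX.
  apply: ler_norm_power_series => //; apply: le_trans (ler_dot _ _) _.
  by rewrite ler_wpM2l ?sumr_ge0// ltW.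
have ucvg t : u ^~ t @ \oo --> U (dot nu (w t)) * g t.
  under eq_fun do rewrite uE.
  apply: cvgMl; exact: cU.
have [] := @dominated_convergence _ T R L (B delta) mB
  (fun K t => (u K t)%:E) (fun t => (U (dot nu (w t)) * g t)%:E) (EFin \o G).
- by move=> K; have [/integrableP[]] := Iu K.
- apply: measurable_funTS; apply/measurable_EFinP; apply: measurable_funM => //.
  by apply: measurableT_comp => //; exact: measurable_dot.
- by apply: aeW => t Bt; apply: cvg_EFin; [exact: nearW|exact: ucvg].
- exact: IG.
- by apply: aeW => t K Bt; rewrite /= lee_fin; exact: uG.
move=> If _ cv.
have fE : (\int[L]_(t in B delta) (U (dot nu (w t)) * g t)%:E)%E =
  (\int[L]_(t in B delta) (U (dot nu (w t)) * g t))%:E.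
  by rewrite fineK//; exact: integrable_fin_num.
move: cv; rewrite fE => /fine_cvgP[_]; apply: cvg_trans.
rewrite (_ : fine \o _ = series (fun k => c k *
    \int[L]_(t in B delta) (dot nu (w t) ^+ (k.*2 + m) * g t)))//.
apply/funext => K; rewrite /series/=.
have [_] := Iu K; rewrite /u {1}/Rintegral => ->.
by apply: eq_bigr => k _; rewrite RintegralZl.
Qed.

End series_integral.

(** * Hypergeometric series *)

Section hypergeometric.
Context {R : realType}.

Lemma pochhammer0 (a : R) : pochhammer a 0 = 1.
Proof. by rewrite /pochhammer big_ord0. Qed.

Lemma pochhammerSr (a : R) k :
  pochhammer a k.+1 = pochhammer a k * (a + k%:R).
Proof. by rewrite /pochhammer big_ord_recr. Qed.

Lemma pochhammerSl (a : R) k : pochhammer a k.+1 = a * pochhammer (a + 1) k.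
Proof.
rewrite /pochhammer big_ord_recl addr0; congr (_ * _).
by apply: eq_bigr => i _; rewrite /bump/= natrD addrA.
Qed.

Lemma pochhammer_gt0 (a : R) k : 0 < a -> 0 < pochhammer a k.
Proof. by move=> a0; apply: prodr_gt0 => i _; rewrite ltr_wpDr. Qed.

Lemma pochhammer_ge1 (a : R) k : 1 <= a -> 1 <= pochhammer a k.
Proof.
move=> a1; elim: k => [|k IH]; first by rewrite pochhammer0.
by rewrite pochhammerSr mulr_ege1// (le_trans a1)// lerDl.
Qed.

Lemma pochhammer1 k : pochhammer (1 : R) k = k`!%:R.
Proof.
elim: k => [|k IH]; first by rewrite pochhammer0.
by rewrite pochhammerSr IH factS natrM mulrC nat1r.
Qed.

Lemma pochhammer2 k : pochhammer (2 : R) k = k.+1`!%:R.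
Proof.
have := pochhammerSl (1 : R) k; rewrite pochhammer1 mul1r => ->.
by congr pochhammer; rewrite -natrD.
Qed.

Lemma pochhammer_ratio (a : R) k : 0 < a ->
  pochhammer a k / pochhammer (a + 1) k = a / (a + k%:R).
Proof.
move=> a0; have := pochhammerSl a k; rewrite pochhammerSr => H.
have p0 := pochhammer_gt0 k (addr_gt0 a0 ltr01).
have ak : 0 < a + k%:R by rewrite ltr_wpDr.
by apply/eqP; rewrite eqr_div ?(gt_eqF p0) ?(gt_eqF ak)// H.
Qed.

(** [hypergeometric] is a [limn], informative only once convergence is known. Coefficients bounded
    by 1 allow comparison with the exponential series at [|z|]. *)
Lemma hypergeometric_cvg (a b : seq R) (z : R) :
  (forall k, `|(\prod_(x <- a) pochhammer x k) / (\prod_(y <- b) pochhammer y k)| <= 1) ->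
  series (fun k => (\prod_(x <- a) pochhammer x k) /
    (\prod_(y <- b) pochhammer y k) * (z ^+ k / k`!%:R)) @ \oo -->
  hypergeometric a b z.
Proof.
move=> H; apply: (@normed_cvg _ R^o).
apply: (series_le_cvg (v_ := exp_coeff `|z|)).
- by move=> k; exact: normr_ge0.
- by move=> k; apply: divr_ge0; [apply: exprn_ge0; exact: normr_ge0|exact: ler0n].
- move=> k; rewrite /exp_coeff/= normrM -[leRHS]mul1r.
  by rewrite ler_pM// normrM normrX normfV [X in _ / X]ger0_norm.
- exact: is_cvg_series_exp_coeff.
Qed.

Variables (n : nat) (beta : R).
Hypothesis (beta_lt : beta < n%:R + 2).
Local Notation N := (n%:R : R).

Let a_gt0 : 0 < (N + 2 - beta) / 2.
Proof. by move: beta_lt; lra. Qed.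

Let a1E : (N + 4 - beta) / 2 = (N + 2 - beta) / 2 + 1.
Proof. by field. Qed.

Let ratio_le1 k : pochhammer ((N + 2 - beta) / 2) k /
  pochhammer ((N + 4 - beta) / 2) k <= 1.
Proof.
rewrite a1E pochhammer_ratio// ler_pdivrMr ?mul1r ?lerDl//.
by rewrite ltr_wpDr.
Qed.

Let ratio_ge0 k : 0 <= pochhammer ((N + 2 - beta) / 2) k /
  pochhammer ((N + 4 - beta) / 2) k.
Proof.
rewrite a1E; apply: divr_ge0; rewrite ltW// pochhammer_gt0//.
by rewrite addr_gt0.
Qed.

(** Parameters that differ by 1 telescope. This ratio is the factor [1 / (n + 2 k + 2 - beta)] of
    the weighted moments, normalised at [k = 0] by [c_scale]. *)
Let ratioE k : pochhammer ((N + 2 - beta) / 2) k /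
  pochhammer ((N + 4 - beta) / 2) k = (N + 2 - beta) / (N + k.*2%:R + 2 - beta).
Proof.
rewrite a1E pochhammer_ratio//.
have h : 0 < N + k.*2%:R + 2 - beta.
  by have := ler0n R k.*2; move: beta_lt; lra.
have -> : (N + 2 - beta) / 2 + k%:R = (N + k.*2%:R + 2 - beta) / 2.
  by rewrite -muln2 natrM; field.
by field; rewrite gt_eqF.
Qed.

Lemma hypergeometric12_cvg b z : 1 <= b ->
  series (fun k => (N + 2 - beta) / (N + k.*2%:R + 2 - beta) *
    (z ^+ k / (pochhammer b k * k`!%:R))) @ \oo -->
  hypergeometric [:: (N + 2 - beta) / 2] [:: b; (N + 4 - beta) / 2] z.
Proof.
move=> b1; have b0 k : 0 < pochhammer b k by apply: pochhammer_gt0; exact: lt_le_trans b1.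
have E k : pochhammer ((N + 2 - beta) / 2) k /
    (pochhammer b k * pochhammer ((N + 4 - beta) / 2) k) =
    (N + 2 - beta) / (N + k.*2%:R + 2 - beta) / pochhammer b k.
  by rewrite -ratioE invfM; ring.
have := @hypergeometric_cvg [:: (N + 2 - beta) / 2] [:: b; (N + 4 - beta) / 2] z.
have -> : (fun k => (\prod_(x <- [:: (N + 2 - beta) / 2]) pochhammer x k) /
    (\prod_(y <- [:: b; (N + 4 - beta) / 2]) pochhammer y k) * (z ^+ k / k`!%:R)) =
  (fun k => (N + 2 - beta) / (N + k.*2%:R + 2 - beta) *
    (z ^+ k / (pochhammer b k * k`!%:R))).
  apply/funext => k; rewrite !big_cons !big_nil !mulr1 E [in RHS]invfM; ring.
apply => k; rewrite !big_cons !big_nil !mulr1 E -ratioE.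
rewrite ger0_norm; last by rewrite divr_ge0// ltW.
rewrite ler_pdivrMr// mul1r.
by apply: le_trans (ratio_le1 k) _; exact: pochhammer_ge1.
Qed.

(** The extra parameters 1 and 2 contribute [k! / (k + 1)!], which turns the factorial [k!] of the
    series into [(k + 1)!]. *)
Lemma hypergeometric23_cvg b z : 1 <= b ->
  series (fun k => (N + 2 - beta) / (N + k.*2%:R + 2 - beta) *
    (z ^+ k / (pochhammer b k * k.+1`!%:R))) @ \oo -->
  hypergeometric [:: 1; (N + 2 - beta) / 2] [:: 2; b; (N + 4 - beta) / 2] z.
Proof.
move=> b1; have b0 k : 0 < pochhammer b k by apply: pochhammer_gt0; exact: lt_le_trans b1.
have E k : pochhammer 1 k * pochhammer ((N + 2 - beta) / 2) k /
    (pochhammer 2 k * (pochhammer b k * pochhammer ((N + 4 - beta) / 2) k)) =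
    (N + 2 - beta) / (N + k.*2%:R + 2 - beta) / pochhammer b k *
    (k`!%:R / k.+1`!%:R).
  by rewrite -ratioE pochhammer1 pochhammer2 !invfM; ring.
have := @hypergeometric_cvg [:: 1; (N + 2 - beta) / 2]
  [:: 2; b; (N + 4 - beta) / 2] z.
have -> : (fun k => (\prod_(x <- [:: 1; (N + 2 - beta) / 2]) pochhammer x k) /
    (\prod_(y <- [:: 2; b; (N + 4 - beta) / 2]) pochhammer y k) *
    (z ^+ k / k`!%:R)) =
  (fun k => (N + 2 - beta) / (N + k.*2%:R + 2 - beta) *
    (z ^+ k / (pochhammer b k * k.+1`!%:R))).
  apply/funext => k; rewrite !big_cons !big_nil !mulr1 E [in RHS]invfM.
  have f0 : k`!%:R != 0 :> R by rewrite pnatr_eq0 -lt0n fact_gt0.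
  set c := (N + 2 - beta) / _.
  rewrite [LHS](_ : _ = (k`!%:R / k`!%:R) * (c * (z ^+ k / pochhammer b k / k.+1`!%:R))).
    by rewrite mulfV// mul1r; ring.
  by ring.
apply => k; rewrite !big_cons !big_nil !mulr1 E -ratioE.
rewrite ger0_norm; last by rewrite mulr_ge0// divr_ge0// ltW.
rewrite -[leRHS]mulr1 ler_pM//.
- by rewrite divr_ge0// ltW.
- rewrite ler_pdivrMr// mul1r.
  by apply: le_trans (ratio_le1 k) _; exact: pochhammer_ge1.
- rewrite ler_pdivrMr ?ltr0n ?fact_gt0// mul1r ler_nat.
  by rewrite factS leq_pmull.
Qed.

(* [(2 k - 1)!! / (2 k)! = 1 / (2 ^ k k!)] *)
Lemma moment_coefficient k :
  \prod_(l < k) (l.*2.+1%:R / (N + l.*2%:R + 2)) / k.*2`!%:R =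
  (4 ^+ k * k`!%:R * pochhammer ((N + 2) / 2) k)^-1.
Proof.
have N0 : 0 <= N by exact: ler0n.
elim: k => [|k IH].
  by rewrite big_ord0 pochhammer0 expr0 mulr1 !mul1r.
rewrite big_ord_recr/= pochhammerSr exprS.
have p0 : 0 < pochhammer ((N + 2) / 2) k by apply: pochhammer_gt0; lra.
have f0 j : 0 < j`!%:R :> R by rewrite ltr0n fact_gt0.
have k0 := ler0n R k.
have -> : k.*2.+2`!%:R = k.*2`!%:R * k.*2.+1%:R * (2 * k.+1%:R) :> R.
  by rewrite !factS !natrM -doubleS -mul2n natrM; ring.
rewrite factS natrM.
have k2 : k.*2%:R = 2 * k%:R :> R by rewrite -mul2n natrM.
have k21 : k.*2.+1%:R = 2 * k%:R + 1 :> R by rewrite -natr1 k2.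
(* The new odd numerator cancels against [(2 k + 2)!], leaving [(n + 2 k + 2) * 2 (k + 1) = 4 (k +
   1) ((n + 2) / 2 + k)]. *)
rewrite [LHS](_ : _ = \prod_(l < k) (l.*2.+1%:R / (N + l.*2%:R + 2)) / k.*2`!%:R *
    (k.*2.+1%:R / k.*2.+1%:R) * ((N + k.*2%:R + 2) * (2 * k.+1%:R))^-1); last first.
  by rewrite !invfM; ring.
rewrite divff ?pnatr_eq0// mulr1 IH k2 -!natr1; field.
have p1 := f0 k; have p2 : 0 < 4 ^+ k :> R by exact: exprn_gt0.
apply/and5P; split.
- by apply: lt0r_neq0; move: N0; lra.
- by rewrite !add0r; exact: (lt0r_neq0 p0).
- exact: (lt0r_neq0 p1).
- by apply: lt0r_neq0; lra.
- rewrite !add0r (_ : 1 + 1 + 1 + 1 = 4); last by ring.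
  exact: (lt0r_neq0 p2).
Qed.

End hypergeometric.

(** * Power series of the sine and of the cosine minus one *)

Section trigonometric_series.
Context {R : realType}.

Lemma cvg_sin_series (x : R) :
  series (fun k => (-1) ^+ k / k.*2.+1`!%:R * x ^+ (k.*2 + 1)) @ \oo --> sin x.
Proof.
rewrite (_ : (fun _ => _) = sin_coeff' x); first exact: cvg_sin_coeff'.
by apply/funext => k; rewrite /sin_coeff' addn1 -exprnP; ring.
Qed.

(** Subtracting 1 removes the constant term; after the shift of index every term keeps the factor
    [x ^ 2] that compensates the weight [beta + 2]. *)
Lemma cvg_cosB1_series (x : R) :
  series (fun k => (-1) ^+ k.+1 / k.*2.+2`!%:R * x ^+ (k.*2 + 2)) @ \oo -->
  cos x - 1.
Proof.
have := @cvg_cos_coeff' R x; rewrite -cvg_shiftS => H.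
rewrite (_ : series _ = fun k => series (cos_coeff' x) k.+1 - 1).
  by apply: cvgB => //; exact: cvg_cst.
apply/funext => K; rewrite /series/= big_nat_recl//.
rewrite {1}/cos_coeff' expr0z fact0 !mulr1 divr1 addrC addKr.
apply: eq_bigr => k _.
by rewrite /cos_coeff' addn2 -exprnP; ring.
Qed.

Lemma ler_norm_sign_fact (k m j : nat) : (k <= m)%N ->
  `|(-1) ^+ j / m`!%:R| <= k`!%:R^-1 :> R.
Proof.
move=> km; rewrite normrM normrX normrN1 expr1n mul1r normfV normr_nat.
rewrite lef_pV2 ?posrE ?ltr0n ?fact_gt0// ler_nat.
exact: leq_fact.
Qed.

Lemma cvg_series_comb (u v s : nat -> R) (p q a b : R) :
  (forall k, s k = p * u k + q * v k) ->
  series u @ \oo --> a -> series v @ \oo --> b ->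
  series s @ \oo --> p * a + q * b.
Proof.
move=> sE ua vb.
rewrite (_ : series s = fun k => p * series u k + q * series v k).
  by apply: cvgD; apply: cvgMr.
by apply/funext => k; rewrite /series/= !mulr_sumr -big_split; exact: eq_bigr.
Qed.

End trigonometric_series.

(** * Entries of the multipliers *)

Section entries.
Context {R : realType} {n : nat}.
Variables (delta beta : R) (nu : 'rV[R]_n).
Hypotheses (n_gt0 : (0 < n)%N) (delta_gt0 : 0 < delta) (beta_lt : beta < n%:R + 2).
Local Notation N := (n%:R : R).
Local Notation z := (- (1 / 4) * enorm nu ^+ 2 * delta ^+ 2).
Local Notation w := rV_of_tuple.

(** The sign comes from the Taylor series, the powers of [enorm nu] and of 4 from the moments, the
    power of [delta] from the radial formula. *)
Let zX k : z ^+ k = (-1) ^+ k * enorm nu ^+ k.*2 * delta ^+ k.*2 / 4 ^+ k.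
Proof.
rewrite -mul2n !exprM -exprVn -!exprMn; congr (_ ^+ k).
by ring.
Qed.

Let powE k : delta `^ (N + k.*2%:R + 2 - beta) =
  delta `^ (N + 2 - beta) * delta ^+ k.*2.
Proof.
have -> : N + k.*2%:R + 2 - beta = (N + 2 - beta) + k.*2%:R by ring.
rewrite powRD; last by rewrite (gt_eqF delta_gt0) implybT.
by rewrite powR_mulrn// ltW.
Qed.

Let prodE k : \prod_(l < k) (l.*2.+1%:R / (n%:R + l.*2%:R + 2)) =
  k.*2`!%:R / (4 ^+ k * k`!%:R * pochhammer ((N + 2) / 2) k).
Proof.
rewrite -moment_coefficient mulrC divfK// pnatr_eq0 -lt0n fact_gt0//.
Qed.

Let momentE k : moment nu k.*2 = volume (n := n) * enorm nu ^+ k.*2 *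
  (k.*2`!%:R / (4 ^+ k * k`!%:R * pochhammer ((N + 2) / 2) k)).
Proof. by rewrite moment_even//; congr (_ * _); exact: prodE. Qed.

Let fact_neq0 k : k`!%:R != 0 :> R.
Proof. by rewrite pnatr_eq0 -lt0n fact_gt0. Qed.

Let poch_neq0 b k : 0 < b -> pochhammer b k != 0 :> R.
Proof. by move=> b0; rewrite gt_eqF// pochhammer_gt0. Qed.

Let N0 : 0 <= N. Proof. exact: ler0n. Qed.

Let a0 : N + 2 - beta != 0.
Proof. by apply: lt0r_neq0; move: beta_lt; lra. Qed.

Let ak0 k : N + k.*2%:R + 2 - beta != 0.
Proof.
apply: lt0r_neq0; have := ler0n R k.*2; move: beta_lt; lra.
Qed.

Let four_neq0 k : 4 ^+ k != 0 :> R.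
Proof. by rewrite expf_neq0// pnatr_eq0. Qed.

(** The square of the prefactor [2 / c_scale] cancels the constant [c_scale ^ 2 / 4] in [M_s]. *)
Lemma sine_momentE i : sine_moment delta beta nu 0 i =
  2 / c_scale n delta beta * nu 0 i *
  hypergeometric [:: (N + 2 - beta) / 2] [:: (N + 2) / 2; (N + 4 - beta) / 2] z.
Proof.
have b1 : 1 <= (N + 2) / 2 by move: N0; lra.
rewrite mxE /Rn_integral.
transitivity (\int[lebesgue_tuple R n]_(t in @rV_of_tuple R n @^-1` eball delta)
    (sin (dot nu (w t)) * (w t 0 i / enorm (w t) `^ beta))).
  by apply: eq_Rintegral => t _; rewrite [LHS]mxE [X in _ * X]mxE [_^-1 * _]mulrC.
pose c k : R := (-1) ^+ k / k.*2.+1`!%:R.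
have W k := weighted_moment1 n_gt0 delta_gt0 beta_lt nu k i.
have mg : measurable_fun setT
    (fun t : n.-tuple (measurableTypeR R) => w t 0 i / enorm (w t) `^ beta).
  by apply: measurable_radial; have [] := @tame_coord R n 1 i.
have := @cvg_series_integral R n c 1 sin nu _ delta _ cvg_sin_series _ mg _.
move=> /(_ _ _ _)/cvg_lim <-//; last 3 first.
- by move=> k; apply: ler_norm_sign_fact; rewrite -addnn -addSn leq_addl.
- by apply: continuous_measurable_fun; exact: continuous_sin.
- by move=> k; rewrite addn1; have [] := W k.
set H := hypergeometric _ _ _.
have hc : series _ @ \oo --> H := hypergeometric12_cvg beta_lt b1.
(* A single series suffices here, so the second coefficient of [cvg_series_comb] is taken to be
   0. *)
apply/cvg_lim => //; rewrite -[X in _ --> X]addr0 -[X in _ + X](mul0r H).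
apply: (cvg_series_comb _ hc hc) => k; rewrite mul0r addr0 addn1.
have [_ ->] := W k.
rewrite powE momentE c_scaleE// zX /c factS natrM.
have p0 : pochhammer ((N + 2) / 2) k != 0 by apply: poch_neq0; lra.
have d0 : delta `^ (N + 2 - beta) != 0 by rewrite gt_eqF// powR_gt0.
have v0 : volume (R := R) (n := n) != 0 by rewrite gt_eqF// volume_gt0.
have f0 := fact_neq0 k; have f1 := fact_neq0 k.*2.
have h1 := a0; have h2 := ak0 k; have f4 := four_neq0 k.
have k1 : k.*2.+1%:R != 0 :> R by rewrite pnatr_eq0.
by field; do ?[apply/andP; split].
Qed.

(** In the [k]-th term [(2 k + 1) * (2 k)! / (2 k + 2)! = 1 / (2 (k + 1))]. On the Kronecker part
    this raises [k!] to [(k + 1)!], giving the 2F3 series; on [nu_i nu_j] the factor [2 k + 2] of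
    the moment undoes it, giving the 1F2 series. *)
Lemma M_bE mu i j : M_b delta beta mu nu i j =
  - mu * enorm nu ^+ 2 * (i == j)%:R *
    hypergeometric [:: 1; (N + 2 - beta) / 2]
      [:: 2; (N + 4) / 2; (N + 4 - beta) / 2] z +
  - 2 * mu * (nu 0 i * nu 0 j) *
    hypergeometric [:: (N + 2 - beta) / 2]
      [:: (N + 4) / 2; (N + 4 - beta) / 2] z.
Proof.
have b1 : 1 <= (N + 4) / 2 by move: N0; lra.
pose K := (N + 2) * mu * c_scale n delta beta.
rewrite !mxE -/K /Rn_integral.
have -> : \int[lebesgue_tuple R n]_(t in @rV_of_tuple R n @^-1` eball delta)
    ((cos (dot nu (w t)) - 1) *: ((enorm (w t) `^ (beta + 2))^-1 *: tensor (w t) (w t))) i j =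
  \int[lebesgue_tuple R n]_(t in @rV_of_tuple R n @^-1` eball delta)
    ((cos (dot nu (w t)) - 1) * (w t 0 i * w t 0 j / enorm (w t) `^ (beta + 2))).
  apply: eq_Rintegral => t _.
  by rewrite [LHS]mxE [X in _ * X]mxE [X in _ * (_ * X)]mxE [_^-1 * _]mulrC.
pose c k : R := (-1) ^+ k.+1 / k.*2.+2`!%:R.
have W k := weighted_moment2 n_gt0 delta_gt0 beta_lt nu k i j.
have mg : measurable_fun setT (fun t : n.-tuple (measurableTypeR R) =>
    w t 0 i * w t 0 j / enorm (w t) `^ (beta + 2)).
  apply: (measurable_radial (P := fun t => w t 0 i * w t 0 j)).
  by apply: measurable_funM; [have [] := @tame_coord R n 1 i|have [] := @tame_coord R n 1 j].
have := @cvg_series_integral R n c 2 (fun x => cos x - 1) nu _ delta _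
  cvg_cosB1_series _ mg _.
move=> /(_ _ _ _)/cvg_lim <-//; last 3 first.
- by move=> k; apply: ler_norm_sign_fact; rewrite -addnn -!addSn leq_addl.
- apply: measurable_funB => //.
  by apply: continuous_measurable_fun; exact: continuous_cos.
- by move=> k; rewrite addn2; have [] := W k.
set H23 := hypergeometric [:: 1; _] _ _; set H12 := hypergeometric [:: (_ / _)] _ _.
have h23 : series _ @ \oo --> H23 := hypergeometric23_cvg beta_lt b1.
have h12 : series _ @ \oo --> H12 := hypergeometric12_cvg beta_lt b1.
have d0 : delta `^ (N + 2 - beta) != 0 by rewrite gt_eqF// powR_gt0.
have v0 : volume (R := R) (n := n) != 0 by rewrite gt_eqF// volume_gt0.
have h1 := a0.
have N2 : N + 2 != 0 by apply: lt0r_neq0; move: N0; lra.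
have cE := c_scaleE n_gt0 delta_gt0 beta_lt.
have c0 : c_scale n delta beta != 0.
  by rewrite cE !mulf_neq0 ?invr_neq0 ?mulf_neq0 ?pnatr_eq0.
(* The target coefficients divided by [K], with [mu] left out of both sides so that [mu = 0] is not
   a separate case. *)
pose p := - (enorm nu ^+ 2 * (i == j)%:R) / ((N + 2) * c_scale n delta beta).
pose q := - 2 * (nu 0 i * nu 0 j) / ((N + 2) * c_scale n delta beta).
suff -> : limn (series (fun k => c k *
    \int[lebesgue_tuple R n]_(t in @rV_of_tuple R n @^-1` eball delta)
      (dot nu (w t) ^+ (k.*2 + 2) *
       (w t 0 i * w t 0 j / enorm (w t) `^ (beta + 2))))) = p * H23 + q * H12.
  by rewrite /K /p /q; field; rewrite c0.
apply/cvg_lim => //; apply: (cvg_series_comb _ h23 h12) => k; rewrite addn2.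
have [_ ->] := W k.
rewrite powE momentE /p /q cE zX /c.
have p0 : pochhammer ((N + 4) / 2) k != 0 by apply: poch_neq0; move: N0; lra.
have p1 : pochhammer ((N + 2) / 2) k != 0 by apply: poch_neq0; move: N0; lra.
(* The denominator [n + 2 k + 2] extends the Pochhammer symbol of [(n + 2) / 2] by one factor;
   splitting off its first factor instead yields the lower parameter [(n + 4) / 2] and the [n + 2]
   that the prefactor of [M_b] cancels. *)
have pE : pochhammer ((N + 2) / 2) k = (N + 2) / 2 *
    pochhammer ((N + 4) / 2) k / ((N + 2) / 2 + k%:R).
  have k0 : (N + 2) / 2 + k%:R != 0.
    by apply: lt0r_neq0; have := ler0n R k; move: N0; lra.
  apply: (mulIf k0); rewrite mulfVK// -pochhammerSr pochhammerSl.
  by congr (_ * pochhammer _ _); field.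
rewrite pE.
have f0 := fact_neq0 k; have f1 := fact_neq0 k.*2.
have h2 := ak0 k; have f4 := four_neq0 k.
have k0 := ler0n R k.
have k2 : k.*2%:R = 2 * k%:R :> R by rewrite -mul2n natrM.
have k1 : k.*2.+1%:R = 2 * k%:R + 1 :> R by rewrite -natr1 k2.
have k3 : k.*2.+2%:R = 2 * k%:R + 2 :> R by rewrite -natr1 k1; ring.
rewrite !factS !natrM k3 k1 k2 -[k.+1%:R]natr1 [(-1) ^+ k.+1]exprS.
have e1 : N + 2 * k%:R + 2 - beta != 0 by have := h2; rewrite k2.
have e2 : k%:R + 1 != 0 :> R by apply: lt0r_neq0; lra.
have e3 : N + 2 + k%:R * 2 != 0 by apply: lt0r_neq0; move: N0; lra.
have e4 : 2 * k%:R + 1 != 0 :> R by apply: lt0r_neq0; lra.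
have e5 : 2 * k%:R + 2 != 0 :> R by apply: lt0r_neq0; lra.
by field; do ?[apply/andP; split].
Qed.

End entries.

Unset Implicit Arguments.

Theorem proposition3 (R : realType) (n : nat) (delta beta mu lambda : R)
    (n_ge1 : (1 <= n)%N) (delta_gt0 : 0 < delta) (beta_lt : beta < n%:R + 2)
    (nu : 'rV[R]_n) :
  let N := n%:R : R in
  let z := - (1 / 4) * enorm nu ^+ 2 * delta ^+ 2 in
  M_b delta beta mu nu =
    (- mu * enorm nu ^+ 2 *
      hypergeometric [:: 1; (N + 2 - beta) / 2]
                     [:: 2; (N + 4) / 2; (N + 4 - beta) / 2] z) *: 1%:M
    - (2 * mu *
      hypergeometric [:: (N + 2 - beta) / 2]
                     [:: (N + 4) / 2; (N + 4 - beta) / 2] z) *: tensor nu nu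
  /\
  M_s delta beta mu lambda nu =
    (- (lambda - mu) *
      hypergeometric [:: (N + 2 - beta) / 2]
                     [:: (N + 2) / 2; (N + 4 - beta) / 2] z ^+ 2)
      *: tensor nu nu.
Proof.
move=> N z; split; apply/matrixP => i j.
  by rewrite M_bE// !mxE; ring.
have c0 : c_scale n delta beta != 0.
  rewrite c_scaleE//; apply: lt0r_neq0.
  apply: divr_gt0; first by apply: mulr_gt0 => //; move: beta_lt; lra.
  by rewrite mulr_gt0 ?powR_gt0 ?volume_gt0.
rewrite mxE [X in _ * X]mxE !sine_momentE// [in RHS]mxE [X in _ = _ * X]mxE.
by field.
Qed.
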